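(* If $\mathcal F=\{{}^bK_3,{}^rK_3,{}^{rrb}K_3\}$ or $\mathcal F=\{{}^bK_3,{}^rK_3,{}^{rbb}K_3\}$, then the $\mathcal F$-free colouring problem is NP-complete.
   Context: Graphs are finite and simple. A $2$-edge-colouring of $G$ assigns to every edge the colour red or blue (not necessarily properly). For a set $\mathcal F$ of $2$-edge-coloured graphs, a $2$-edge-colouring of $G$ is $\mathcal F$-free if no induced $2$-edge-coloured subgraph is isomorphic (preserving colours) to a member of $\mathcal F$. The $\mathcal F$-free colouring problem is to decide whether an input graph $G$ admits an $\mathcal F$-free $2$-edge-colouring. ${}^rK_3$ (resp. ${}^bK_3$) is the triangle with all edges red (resp. blue); ${}^{rrb}K_3$ is the triangle with two red and one blue edge; ${}^{rbb}K_3$ is the triangle with one red and two blue edges. *)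

(* Defs.v *)
(* MathComp world. *)
From HB Require Import structures.
From mathcomp Require Import all_boot all_order all_algebra.

Set Implicit Arguments.
Unset Strict Implicit.
Unset Printing Implicit Defensive.

(** * Graphs and 2-edge-coloured graphs *)

Record graph := Graph {
  vertex :> finType;
  adj : rel vertex;
  adj_sym : symmetric adj;
  adj_irr : irreflexive adj }.

Variant colour := Red | Blue.

(* The colour of the edge xy is [c [set x; y]]; the values of [c] on sets which
   are not edges are never used. *)
Definition colouring (G : graph) := {set G} -> colour.

Record cgraph := CGraph {
  underlying :> graph;
  ecol : colouring underlying }.

Definition cgraph_iso (H K : cgraph) : Prop :=
  exists f : H -> K,
    [/\ bijective f,
        forall x y, adj (f x) (f y) = adj x y
      & forall x y, adj x y -> ecol [set f x; f y] = ecol [set x; y]].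

Section Induced.
Variables (K : cgraph) (S : {set K}).

Let T : finType := {x : K | x \in S}.
Let iadj : rel T := fun x y => adj (val x) (val y).

Lemma induced_sym : symmetric iadj.
Proof. by move=> x y; rewrite /iadj adj_sym. Qed.

Lemma induced_irr : irreflexive iadj.
Proof. by move=> x; rewrite /iadj adj_irr. Qed.

Definition induced : cgraph :=
  @CGraph (Graph induced_sym induced_irr) (fun e => ecol (val @: e)).

End Induced.

(* Predicates, since [set cgraph] of mathcomp-classical is rejected for universe
   reasons. *)
Definition cfamily := cgraph -> Prop.

Definition cfamily3 (A B C : cgraph) : cfamily :=
  fun K => [\/ K = A, K = B | K = C].

Definition is_free (F : cfamily) (K : cgraph) : Prop :=
  forall (S : {set K}) (H : cgraph), F H -> ~ cgraph_iso (induced S) H.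

Definition free_colourable (F : cfamily) (G : graph) : Prop :=
  exists c : colouring G, is_free F (CGraph c).

Lemma K3_sym : symmetric (fun x y : 'I_3 => x != y).
Proof. by move=> x y; rewrite eq_sym. Qed.

Lemma K3_irr : irreflexive (fun x y : 'I_3 => x != y).
Proof. by move=> x; rewrite eqxx. Qed.

Definition K3 : graph := Graph K3_sym K3_irr.

Definition rK3 : cgraph := @CGraph K3 (fun=> Red).
Definition bK3 : cgraph := @CGraph K3 (fun=> Blue).

(* Two of the three edges of the triangle contain the vertex 0. *)
Definition rrbK3 : cgraph :=
  @CGraph K3 (fun e => if ord0 \in e then Red else Blue).
Definition rbbK3 : cgraph :=
  @CGraph K3 (fun e => if ord0 \in e then Blue else Red).

(** * Deterministic multi-tape Turing machines *)

Variant move := Left | Stay | Right.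

Section Tapes.
Variable A : finType.

(* Tape symbols: [None] is the blank, [Some (inl b)] is the bit b, and
   [Some (inr a)] is an auxiliary symbol. *)
Definition symbol : finType := option (bool + A)%type.

(* (l, r) is a two-way infinite tape: l lists the cells to the left of the head,
   nearest first, r those from the scanned cell rightwards; all the cells beyond
   the ends of l and r are blank. *)
Definition tape : Type := (seq symbol * seq symbol)%type.

Definition read_tape (t : tape) : symbol := head None t.2.

Definition write_tape (s : symbol) (t : tape) : tape := (t.1, s :: behead t.2).

Definition move_tape (m : move) (t : tape) : tape :=
  match m with
  | Left => (behead t.1, head None t.1 :: t.2)
  | Stay => t
  | Right => (head None t.2 :: t.1, behead t.2)
  end.

Definition tape_of (w : seq bool) : tape := ([::], [seq Some (inl b) | b <- w]).

Fixpoint leading_bits (s : seq symbol) : seq bool :=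
  if s is Some (inl b) :: s' then b :: leading_bits s' else [::].

End Tapes.

Record machine := Machine {
  tm_state : finType;
  tm_aux : finType;
  tm_tapes : nat; (* one less than the number of tapes *)
  tm_start : tm_state;
  tm_halt : pred tm_state;
  tm_delta : tm_state -> {ffun 'I_tm_tapes.+1 -> symbol tm_aux} ->
             tm_state * {ffun 'I_tm_tapes.+1 -> symbol tm_aux * move} }.

Section Runs.
Variable M : machine.

Definition config : Type :=
  (tm_state M * {ffun 'I_(tm_tapes M).+1 -> tape (tm_aux M)})%type.

Definition step (c : config) : config :=
  if tm_halt c.1 then c else
  let d := tm_delta c.1 [ffun i => read_tape (c.2 i)] in
  (d.1, [ffun i => move_tape (d.2 i).2 (write_tape (d.2 i).1 (c.2 i))]).

(* The i-th argument is on the i-th tape; the other tapes are blank. *)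
Definition init (ws : seq (seq bool)) : config :=
  (tm_start M, [ffun i : 'I_(tm_tapes M).+1 =>
                  tape_of (tm_aux M) (nth [::] ws i)]).

(* The output is the word on the last tape, read from its head rightwards. *)
Definition output (c : config) : seq bool := leading_bits (c.2 ord_max).2.

Definition outputs_within (t : nat) (ws : seq (seq bool)) (w : seq bool) : Prop :=
  let c := iter t step (init ws) in tm_halt c.1 /\ output c = w.

End Runs.

(** * NP-completeness *)

Definition language := seq bool -> Prop.

Definition polytime1 (f : seq bool -> seq bool) : Prop :=
  exists (M : machine) (p : {poly nat}),
    forall x, outputs_within M p.[size x]%R [:: x] (f x).

Definition polytime2 (f : seq bool -> seq bool -> seq bool) : Prop :=
  exists (M : machine) (p : {poly nat}),
    forall x y, outputs_within M p.[(size x + size y)%N]%R [:: x; y] (f x y).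

Definition in_NP (L : language) : Prop :=
  exists (V : seq bool -> seq bool -> bool) (p : {poly nat}),
    polytime2 (fun x y => [:: V x y]) /\
    forall x, L x <-> exists y, size y <= p.[size x]%R /\ V x y.

Definition poly_reducible (L L' : language) : Prop :=
  exists f, polytime1 f /\ forall x, L x <-> L' (f x).

Definition NP_hard (L : language) : Prop :=
  forall L', in_NP L' -> poly_reducible L' L.

Definition NP_complete (L : language) : Prop := in_NP L /\ NP_hard L.

(** * The colouring problem as a language *)

(* The order of G in unary, a separator, and the adjacency matrix of G row by
   row; this determines G up to isomorphism. *)
Definition encode (G : graph) : seq bool :=
  nseq #|G| true ++ false :: [seq adj x y | x <- enum G, y <- enum G].

Definition free_colouring_problem (F : cfamily) : language :=
  fun w => exists G : graph, free_colourable F G /\ encode G = w.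

(* Main.v *)
(* Counting the edges of the special colour, the problem asks for a set of edges
   meeting every triangle exactly once. A certificate is a matrix of colours. For
   hardness, in a K4 such a set consists of two opposite edges, so that a K4 forces
   two disjoint edges to agree and a triangle is a 1-in-3 constraint on edges. A
   clause with literals l_0, ..., l_(n-1) becomes a chain of 1-in-3 constraints
   selecting one true literal, and the computation of a verifier is described by
   clauses in the style of Cook and Levin, relatively to the heads so that a step
   shifts the tapes. The words involved are computed in polynomial time because
   their length and bits are given by arithmetic expressions with bounded sums,
   which a machine evaluates in unary. *)
Require Import Defs.
From HB Require Import structures.
From mathcomp Require Import all_boot all_order all_algebra zify.
From Stdlib Require Import FunctionalExtensionality.

Set Implicit Arguments.
Unset Strict Implicit.
Unset Printing Implicit Defensive.

(** * Structured multi-tape programs *)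

(** Each edge of a K4 lies in two of its four triangles, which is why the special set is a perfect
    matching. Glued over the edge of a variable and an edge of a constraint triangle, a K4 copies a
    truth value. All triangles of the graph lie in these K4s or are constraint triangles, so nothing
    else is imposed. This relies on the three variables of a constraint being distinct, a condition
    that shapes the 1-in-3 instance. No clause of the tableau makes the symbol of a cell or the
    state unique. Clauses are implications from facts at one time to facts at the next, so a
    satisfying assignment contains every relevant fact of the run on the certificate extracted from
    it, and further true variables do no harm. Polynomial time has to be shown on the machine model
    itself. A fixed expression has values bounded by a fixed polynomial in the input length, so
    unary counters and nested loops stay polynomial; in return, every word built needs a closed
    formula for its bit at position k. *)

Section Programs.

Variable K : nat.
Notation sym := (symbol void).
Notation tapes := {ffun 'I_K.+1 -> tape void}.
Notation reads T := [ffun i => read_tape (T i)].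

Inductive prog :=
| Do of nat & (sym -> sym) & move
| Seq of prog & prog
| If of nat & pred sym & prog & prog
| While of nat & pred sym & prog.

Fixpoint pstate (p : prog) : finType :=
  match p with
  | Do _ _ _ => unit
  | Seq p q => (pstate p + pstate q)%type
  | If _ _ p q => option (pstate p + pstate q)%type
  | While _ _ p => option (pstate p)
  end.

Fixpoint pstart (p : prog) : pstate p :=
  match p return pstate p with
  | Do _ _ _ => tt
  | Seq p q => inl (pstart p)
  | If _ _ p q => None
  | While _ _ p => None
  end.

Definition action := {ffun 'I_K.+1 -> sym * move}.

Definition idle (s : {ffun 'I_K.+1 -> sym}) : action := [ffun i => (s i, Stay)].

Definition act (a : action) (T : tapes) : tapes :=
  [ffun i => move_tape (a i).2 (write_tape (a i).1 (T i))].

(* [None] stands for the exit of the program. *)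
Fixpoint pdelta (p : prog) :
    pstate p -> {ffun 'I_K.+1 -> sym} -> option (pstate p) * action :=
  match p return pstate p -> _ -> option (pstate p) * action with
  | Do i g m => fun _ (s : {ffun 'I_K.+1 -> sym}) =>
      (None, [ffun j : 'I_K.+1 => if j == i :> nat then (g (s j), m) else (s j, Stay)])
  | Seq p q => fun x (s : {ffun 'I_K.+1 -> sym}) =>
      match x with
      | inl x => let d := pdelta x s in
          (Some (if d.1 is Some x' then inl x' else inr (pstart q)), d.2)
      | inr x => let d := pdelta x s in (omap inr d.1, d.2)
      end
  | If i b p q => fun x (s : {ffun 'I_K.+1 -> sym}) =>
      match x with
      | None => (Some (Some (if b (s (inord i)) then inl (pstart p) else inr (pstart q))),
                 idle s)
      | Some (inl x) => let d := pdelta x s in (omap (Some \o inl) d.1, d.2)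
      | Some (inr x) => let d := pdelta x s in (omap (Some \o inr) d.1, d.2)
      end
  | While i b p => fun x (s : {ffun 'I_K.+1 -> sym}) =>
      match x with
      | None => (if b (s (inord i)) then Some (Some (pstart p)) else None, idle s)
      | Some x => let d := pdelta x s in (Some d.1, d.2)
      end
  end.

Inductive exits (p : prog) : pstate p -> tapes -> nat -> tapes -> Prop :=
| exits_now (x : pstate p) (T : tapes) a :
    pdelta x (reads T) = (None, a) -> exits x T 1 (act a T)
| exits_later (x : pstate p) (T : tapes) x' a n (T' : tapes) :
    pdelta x (reads T) = (Some x', a) -> exits x' (act a T) n T' ->
    exits x T n.+1 T'.

Definition runs p (T : tapes) n (T' : tapes) := exits (pstart p) T n T'.

(** Writing back the scanned symbol turns an empty right part into one blank cell: an idle step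
    changes the lists though not the tape they denote. Invariants on tapes are therefore stated
    through [nth None]. *)
Definition skip (T : tapes) : tapes := act (idle (reads T)) T.

Lemma runs_Do i g m (T : tapes) :
  runs (Do i g m) T 1
    [ffun j : 'I_K.+1 => if j == i :> nat then move_tape m (write_tape (g (read_tape (T j))) (T j))
               else skip T j].
Proof.
set T' := finfun _.
suff -> : T' = act [ffun j : 'I_K.+1 => if j == i :> nat then (g ((reads T) j), m)
                                 else ((reads T) j, Stay)] T by exact: exits_now.
by apply/ffunP => j; rewrite !ffunE; case: ifP.
Qed.

Lemma exits_inr p q x T n T' :
  @exits q x T n T' -> exits (inr x : pstate (Seq p q)) T n T'.
Proof.
elim=> {x T n T'} [x T a d|x T x' a n T' d _ IH].
  by apply: (exits_now (p := Seq p q)); rewrite /= d.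
by apply: (exits_later (p := Seq p q)) IH; rewrite /= d.
Qed.

Lemma exits_inl p q x T n T' m T'' :
  @exits p x T n T' -> runs q T' m T'' ->
  exits (inl x : pstate (Seq p q)) T (n + m) T''.
Proof.
move=> e r; elim: e r => {x T n T'} [x T a d r|x T x' a n T' d _ IH r].
  by apply: (exits_later (p := Seq p q) (a := a)) (exits_inr p r); rewrite /= d.
by rewrite addSn; apply: (exits_later (p := Seq p q) (a := a)) (IH r); rewrite /= d.
Qed.

Lemma runs_Seq p q T n T' m T'' :
  runs p T n T' -> runs q T' m T'' -> runs (Seq p q) T (n + m) T''.
Proof. exact: exits_inl. Qed.

Lemma runs_If_true i (b : pred sym) p q (T : tapes) n T' :
  b (read_tape (T (inord i))) -> runs p (skip T) n T' -> runs (If i b p q) T n.+1 T'.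
Proof.
move=> bT r; apply: (exits_later (p := If i b p q) (a := idle (reads T))
  (x' := Some (inl (pstart p)))).
  by rewrite /= ffunE bT.
rewrite -/(skip T); elim: r => {T n T' bT} [x T a d|x T x' a n T' d _ IH].
  by apply: (exits_now (p := If i b p q)); rewrite /= d.
by apply: (exits_later (p := If i b p q)) IH; rewrite /= d.
Qed.

Lemma runs_If_false i (b : pred sym) p q (T : tapes) n T' :
  ~~ b (read_tape (T (inord i))) -> runs q (skip T) n T' -> runs (If i b p q) T n.+1 T'.
Proof.
move=> bT r; apply: (exits_later (p := If i b p q) (a := idle (reads T))
  (x' := Some (inr (pstart q)))).
  by rewrite /= ffunE (negPf bT).
rewrite -/(skip T); elim: r => {T n T' bT} [x T a d|x T x' a n T' d _ IH].
  by apply: (exits_now (p := If i b p q)); rewrite /= d.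
by apply: (exits_later (p := If i b p q)) IH; rewrite /= d.
Qed.

Lemma runs_While_false i (b : pred sym) p (T : tapes) :
  ~~ b (read_tape (T (inord i))) -> runs (While i b p) T 1 (skip T).
Proof.
by move=> bT; apply: (exits_now (p := While i b p)); rewrite /= ffunE (negPf bT).
Qed.

Lemma runs_While_true i (b : pred sym) p (T : tapes) n T' m T'' :
  b (read_tape (T (inord i))) -> runs p (skip T) n T' ->
  runs (While i b p) T' m T'' -> runs (While i b p) T (n + m).+1 T''.
Proof.
move=> bT r r'; apply: (exits_later (p := While i b p) (a := idle (reads T))
  (x' := Some (pstart p))).
  by rewrite /= ffunE bT.
rewrite -/(skip T); elim: r r' => {T n T' bT} [x T a d|x T x' a n T' d _ IH] r'.
  by apply: (exits_later (p := While i b p) (a := a)) r'; rewrite /= d.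
by rewrite addSn; apply: (exits_later (p := While i b p) (a := a)) (IH r'); rewrite /= d.
Qed.

Definition machine_of (p : prog) : machine :=
  @Machine (option (pstate p)) void K (Some (pstart p)) (fun x => x == None)
    (fun x s => if x is Some x then pdelta x s else (None, idle s)).

Lemma runs_machine p T n T' :
  runs p T n T' -> iter n (@step (machine_of p)) (Some (pstart p), T) = (None, T').
Proof.
rewrite /runs; elim=> {T n T'} [x T a d|x T x' a n T' d _ IH].
  by rewrite /= /step /= d.
by rewrite iterSr /step /= d.
Qed.

End Programs.

(** * Counters on tapes *)

(** Tapes 0 and 1 carry the inputs, tape [r.+2] register [r], the last tape the output; [ipos] gives
    the head positions on the two inputs. *)
Record rstate := RState {
  regs : nat -> nat;
  ipos : bool -> nat;
  written : seq bool }.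

Definition upd (T : eqType) (U : Type) (f : T -> U) x y := fun z => if z == x then y else f z.

Definition set_reg s r v := RState (upd (regs s) r v) (ipos s) (written s).
Definition set_ipos s b v := RState (regs s) (upd (ipos s) b v) (written s).
Definition emitted s c := RState (regs s) (ipos s) (c :: written s).

Section Registers.

Variables (R : nat) (w : bool -> seq bool).
Notation sym := (symbol void).
Notation tapes := {ffun 'I_R.+3 -> tape void}.
Notation bits u := [seq (Some (inl c) : sym) | c <- u].

Definition mark : sym := Some (inl true).

Definition input_tape u p (t : tape void) :=
  (forall k, nth None t.2 k = nth None (bits u) (p + k)) /\
  (forall k, nth None t.1 k = if k < p then nth None (bits u) (p - k.+1) else None).

(* The cell where the counter stood at 0 is blank, the next v cells are not. *)
Definition counter_tape v (t : tape void) :=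
  forall k, k <= v -> nth None (read_tape t :: t.1) k = if k == v then None else mark.

Definition output_tape u (t : tape void) :=
  forall k, nth None t.2 k = nth None (bits u) k.

Definition represents s (T : tapes) :=
  [/\ forall b : bool, input_tape (w b) (ipos s b) (T (inord b)),
      forall r, r < R -> counter_tape (regs s r) (T (inord r.+2))
    & output_tape (written s) (T ord_max)].

Definition exec (p : prog) s n s' :=
  forall T, represents s T ->
  exists m T', [/\ m <= n, runs p T m T' & represents s' T'].

Definition tests i (b : pred sym) s c :=
  forall T, represents s T -> b (read_tape (T (inord i))) = c.

Lemma nth_norm (l : seq sym) k : nth None (head None l :: behead l) k = nth None l k.
Proof. by case: l => [|x l] //=; case: k => //= k; rewrite nth_nil. Qed.

Lemma skipE (T : tapes) j :
  skip T j = ((T j).1, head None (T j).2 :: behead (T j).2).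
Proof. by rewrite !ffunE /=. Qed.

Lemma input_tape_norm u p t :
  input_tape u p t -> input_tape u p (t.1, head None t.2 :: behead t.2).
Proof. by case=> h1 h2; split=> k /=; rewrite ?nth_norm. Qed.

Lemma counter_tape_norm v t :
  counter_tape v t -> counter_tape v (t.1, head None t.2 :: behead t.2).
Proof. by []. Qed.

Lemma output_tape_norm u t :
  output_tape u t -> output_tape u (t.1, head None t.2 :: behead t.2).
Proof. by move=> h k; rewrite nth_norm. Qed.

Lemma represents_skip s T : represents s T -> represents s (skip T).
Proof.
case=> h1 h2 h3; split=> [b|r rR|]; rewrite skipE.
- exact: input_tape_norm.
- exact/counter_tape_norm/h2.
- exact: output_tape_norm.
Qed.

Lemma val_reg r : r < R -> (inord r.+2 : 'I_R.+3) = r.+2 :> nat.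
Proof. by move=> rR; rewrite inordK //; lia. Qed.

Lemma val_input (b : bool) : (inord b : 'I_R.+3) = b :> nat.
Proof. by rewrite inordK //; case: b. Qed.

Lemma exec_weaken p s n s' m : exec p s n s' -> n <= m -> exec p s m s'.
Proof.
move=> e nm T /e[k [T' [kn r h]]]; exists k, T'; split=> //; exact: leq_trans nm.
Qed.

Lemma exec_Seq p q s n s' m s'' :
  exec p s n s' -> exec q s' m s'' -> exec (Seq p q) s (n + m) s''.
Proof.
move=> e f T /e[k [T' [kn r /f[l [T'' [lm r' h]]]]]].
by exists (k + l), T''; split=> //; [rewrite leq_add | exact: runs_Seq r'].
Qed.

Lemma exec_If i b p q s c n s' :
  tests i b s c -> exec (if c then p else q) s n s' -> exec (If i b p q) s n.+1 s'.
Proof.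
move=> t e T rT; have := t _ rT; case: c e {t} => e bT;
  have [k [T' [kn r h]]] := e _ (represents_skip rT); exists k.+1, T'; split=> //.
  by apply: runs_If_true r; rewrite bT.
by apply: runs_If_false r; rewrite bT.
Qed.

Lemma exec_While_false i b p s : tests i b s false -> exec (While i b p) s 1 s.
Proof.
move=> t T rT; exists 1, (skip T); split=> //; last exact: represents_skip.
by apply: runs_While_false; rewrite t.
Qed.

Lemma exec_While_true i b p s n s' m s'' :
  tests i b s true -> exec p s n s' -> exec (While i b p) s' m s'' ->
  exec (While i b p) s (n + m).+1 s''.
Proof.
move=> t e f T rT; have [k [T' [kn r]]] := e _ (represents_skip rT).
move=> /f[l [T'' [lm r' h]]].
exists (k + l).+1, T''; split=> //; first by rewrite ltnS leq_add.
by apply: runs_While_true r r'; rewrite t.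
Qed.

Lemma exec_Do_input b m s p' :
  (forall t, input_tape (w b) (ipos s b) t ->
     input_tape (w b) p' (move_tape m (write_tape (read_tape t) t))) ->
  exec (Do (nat_of_bool b) id m) s 1 (set_ipos s b p').
Proof.
move=> H T [h1 h2 h3]; eexists 1, _; split=> //; first exact: runs_Do.
split=> [b'|r rR|]; rewrite ffunE skipE.
- rewrite val_input /= /upd; case: (eqVneq b' b) => [->|nb].
    by rewrite eqxx; apply: H.
  by case: eqP => [|_]; [move: nb; case: (b) (b') => [] [] | apply: input_tape_norm].
- rewrite val_reg // ifN; last by case: (b).
  exact/counter_tape_norm/h2.
- rewrite ifN; last by case: (b).
  exact: output_tape_norm.
Qed.

Lemma exec_Do_counter r g m s v :
  r < R ->
  (forall t, counter_tape (regs s r) t ->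
     counter_tape v (move_tape m (write_tape (g (read_tape t)) t))) ->
  exec (Do r.+2 g m) s 1 (set_reg s r v).
Proof.
move=> rR H T [h1 h2 h3]; eexists 1, _; split=> //; first exact: runs_Do.
split=> [b|r' r'R|]; rewrite ffunE skipE.
- rewrite val_input ifN; last by case: b.
  exact: input_tape_norm.
- rewrite val_reg // /= /upd !eqSS; case: eqP => [->|nb]; first by apply/H/h2.
  exact/counter_tape_norm/h2.
- rewrite ifN; last by rewrite /= !eqSS; lia.
  exact: output_tape_norm.
Qed.

(** [Dec] erases nothing: the cells to the right of the head of a counter are unconstrained, and
    [Inc] overwrites the cell it enters. *)
Definition Inc r : prog := Seq (Do r.+2 id Right) (Do r.+2 (fun=> mark) Stay).
Definition Dec r : prog := Do r.+2 id Left.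
Definition InRight (b : bool) : prog := Do b id Right.
Definition InLeft (b : bool) : prog := Do b id Left.
Definition Emit c : prog := Seq (Do R.+2 id Left) (Do R.+2 (fun=> Some (inl c)) Stay).
Definition nonblank : pred sym := fun x => x != None.

Lemma exec_InRight b s : exec (InRight b) s 1 (set_ipos s b (ipos s b).+1).
Proof.
apply: exec_Do_input => t [h1 h2]; split=> k /=.
  by rewrite nth_behead h1 addnS.
case: k => [|k] /=; first by rewrite /read_tape -nth0 h1 subn1 addn0.
by rewrite h2 ltnS subSS.
Qed.

Lemma exec_InLeft b s p :
  ipos s b = p.+1 -> exec (InLeft b) s 1 (set_ipos s b p).
Proof.
move=> E; apply: exec_Do_input => t; rewrite E => -[h1 h2]; split=> k /=.
  case: k => [|k] /=; first by rewrite -nth0 h2 /= subn1 addn0.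
  by rewrite nth_norm h1 addSnnS.
by rewrite nth_behead h2 ltnS subSS.
Qed.

Lemma exec_Dec r s v : r < R -> regs s r = v.+1 -> exec (Dec r) s 1 (set_reg s r v).
Proof.
move=> rR E; apply: exec_Do_counter => // t; rewrite E => h k kv.
have := h k.+1 kv; rewrite eqSS => <-; case: k {kv} => [|k] /=.
  by rewrite -nth0.
by rewrite nth_behead.
Qed.

Lemma exec_Inc r s : r < R -> exec (Inc r) s 2 (set_reg s r (regs s r).+1).
Proof.
move=> rR T [h1 h2 h3]; eexists 2, _; split=> //.
  by apply: (runs_Seq (n := 1) (m := 1)); apply: runs_Do.
split=> [b|r' r'R|]; rewrite !(ffunE, skipE).
- rewrite val_input; have -> : (b == r.+2 :> nat) = false by case: b.
  exact/input_tape_norm/input_tape_norm.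
- rewrite val_reg // /= /upd !eqSS; case: eqP => [->|nb].
    move=> [//|k] /=; rewrite ltnS eqSS => kv; exact: h2.
  exact/counter_tape_norm/counter_tape_norm/h2.
- have -> : (@ord_max R.+2 == r.+2 :> nat) = false by rewrite /= !eqSS; lia.
  exact/output_tape_norm/output_tape_norm.
Qed.

Lemma exec_Emit c s : exec (Emit c) s 2 (emitted s c).
Proof.
move=> T [h1 h2 h3]; eexists 2, _; split=> //.
  by apply: (runs_Seq (n := 1) (m := 1)); apply: runs_Do.
split=> [b|r rR|]; rewrite !(ffunE, skipE).
- rewrite val_input; have -> : (b == R.+2 :> nat) = false by case: b.
  exact/input_tape_norm/input_tape_norm.
- rewrite val_reg //; have -> : (r.+2 == R.+2) = false by rewrite !eqSS; lia.
  exact/counter_tape_norm/counter_tape_norm/h2.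
- by rewrite /= eqxx => -[|k] //=; rewrite nth_norm h3.
Qed.

Lemma tests_counter r s : r < R -> tests r.+2 nonblank s (regs s r != 0).
Proof.
move=> rR T [_ /(_ r rR) h _]; rewrite /nonblank.
by have /= -> := h 0 isT; case: (regs s r).
Qed.

Lemma tests_input (b : bool) s : tests b nonblank s (ipos s b < size (w b)).
Proof.
move=> T [/(_ b)[h _] _ _]; rewrite /nonblank /read_tape -nth0 h addn0.
case: ltnP => lt; first by rewrite (nth_map false).
by rewrite nth_default // size_map.
Qed.

Lemma tests_bit (b : bool) s : tests b (pred1 mark) s (nth false (w b) (ipos s b)).
Proof.
move=> T [/(_ b)[h _] _ _]; rewrite /read_tape -nth0 h addn0 /=.
case: (ltnP (ipos s b) (size (w b))) => lt.
  by rewrite (nth_map false) //; case: nth.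
by rewrite !nth_default // size_map.
Qed.

Definition start_state := RState (fun=> 0) (fun=> 0) [::].

Lemma represents_init :
  represents start_state
    [ffun i : 'I_R.+3 => tape_of void (nth [::] [:: w false; w true] i)].
Proof.
split=> [b|r rR|]; rewrite ffunE.
- rewrite val_input; split=> k /=; last by rewrite nth_nil.
  by case: b.
- by rewrite val_reg //= nth_nil => -[].
- by rewrite /= nth_nil => k.
Qed.

Lemma output_tapeE u t : output_tape u t -> leading_bits t.2 = u.
Proof.
case: t => l r; rewrite /output_tape /= => h; elim: u r h => [|c u IH] [|x r] h //=.
- by have /= -> := h 0.
- by have := h 0.
- by have /= -> := h 0; rewrite IH // => k; apply: (h k.+1).
Qed.

(** A halted machine stands still, so its output is still there at the one time that
    [outputs_within] inspects. *)
Lemma exec_outputs p n s :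
  exec p start_state n s -> forall m, n <= m ->
  outputs_within (machine_of R.+2 p) m [:: w false; w true] (written s).
Proof.
move=> /(_ _ represents_init)[k [T' [kn r [_ _ h]]]] m nm.
rewrite /outputs_within.
have -> : iter m (@step (machine_of R.+2 p)) (init (machine_of R.+2 p) [:: w false; w true])
   = (None, T').
  rewrite -(subnK (leq_trans kn nm)) iterD /init /= (runs_machine r).
  by elim: (m - k) => //= j ->.
by split=> //; exact: output_tapeE.
Qed.

End Registers.

(** * Arithmetic expressions *)

(* Variables are de Bruijn indices: [Sum e f] binds in f a variable running below
   the value of e, [Shift e] skips the innermost variable, [Minus] is truncated. *)
Inductive expr :=
| Var of nat
| One
| Plus of expr & expr
| Minus of expr & expr
| Sum of expr & expr
| Shift of expr
| Bit of bool & expr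
| Size of bool.

Fixpoint eval (w : bool -> seq bool) (e : expr) (rho : seq nat) : nat :=
  match e with
  | Var i => nth 0 rho i
  | One => 1
  | Plus e f => eval w e rho + eval w f rho
  | Minus e f => eval w e rho - eval w f rho
  | Sum e f => \sum_(k < eval w e rho) eval w f (val k :: rho)
  | Shift e => eval w e (behead rho)
  | Bit b e => nth false (w b) (eval w e rho)
  | Size b => size (w b)
  end.

Definition Skip : prog := Do 0 id Stay.

(** The body runs with the register already decremented: a body preserving it sees v - 1, ..., 0
    when the register starts at v. *)
Definition Loop r (p : prog) : prog := While r.+2 nonblank (Seq (Dec r) p).

(* [compile e m d] adds the value of e to register d, where register [nth 0 m i]
   holds the i-th variable and the registers from d on are initially 0. *)
Fixpoint compile (e : expr) (m : seq nat) (d : nat) : prog :=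
  match e with
  | Var i =>
      if i < size m then
        Seq (Loop (nth 0 m i) (Seq (Inc d) (Inc d.+1))) (Loop d.+1 (Inc (nth 0 m i)))
      else Skip
  | One => Inc d
  | Plus e f => Seq (compile e m d) (Seq (compile f m d.+1) (Loop d.+1 (Inc d)))
  | Minus e f =>
      Seq (compile e m d)
        (Seq (compile f m d.+1) (Loop d.+1 (If d.+2 nonblank (Dec d) Skip)))
  | Sum e f =>
      Seq (compile e m d.+1)
        (Seq (Loop d.+1 (Seq (compile f (d.+2 :: m) d.+3)
                           (Seq (Loop d.+3 (Inc d)) (Inc d.+2))))
           (Loop d.+2 Skip))
  | Shift e => compile e (behead m) d
  | Bit b e =>
      Seq (compile e m d.+1)
        (Seq (Loop d.+1 (Seq (Inc d.+2) (InRight b)))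
           (Seq (If b (pred1 mark) (Inc d) Skip) (Loop d.+2 (InLeft b))))
  | Size b =>
      Seq (While b nonblank (Seq (InRight b) (Seq (Inc d) (Inc d.+1))))
        (Loop d.+1 (InLeft b))
  end.

Fixpoint room (e : expr) : nat :=
  match e with
  | Var _ | One | Size _ => 2
  | Plus e f | Minus e f => room e + room f + 2
  | Sum e f => room e + room f + 4
  | Shift e => room e
  | Bit _ e => room e + 3
  end.

(** Here [n] bounds the input lengths and all variables; the variable bound by a [Sum] is below the
    value of [e], hence the argument [n + vbound e n]. *)
Fixpoint vbound (e : expr) (n : nat) : nat :=
  match e with
  | Var _ | Size _ => n
  | One | Bit _ _ => 1
  | Plus e f => vbound e n + vbound f n
  | Minus e f => vbound e n
  | Sum e f => vbound e n * vbound f (n + vbound e n)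
  | Shift e => vbound e n
  end.

Fixpoint tbound (e : expr) (n : nat) : nat :=
  match e with
  | Var _ => 10 * n + 2
  | One => 2
  | Plus e f | Minus e f => tbound e n + tbound f n + 4 * vbound f n + 1
  | Sum e f =>
      tbound e n +
      vbound e n * (tbound f (n + vbound e n) + 4 * vbound f (n + vbound e n) + 8) + 2
  | Shift e => tbound e n
  | Bit _ e => tbound e n + 8 * vbound e n + 5
  | Size _ => 9 * n + 2
  end.

(** The base is at least 2, so that the exponent absorbs constants and sums. *)
Definition poly_bounded (f : nat -> nat) := exists k, forall n, f n <= (n + 2) ^ k.

Lemma pb_id : poly_bounded id.
Proof. by exists 1 => n; rewrite expn1 leq_addr. Qed.

Lemma pb_const c : poly_bounded (fun=> c).
Proof.
exists c => n; apply: leq_trans (ltnW (ltn_expl c (isT : 1 < 2))) _.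
by case: c => // c; rewrite leq_exp2r // leq_addl.
Qed.

(** For positive a and b, a + b <= 2ab <= (n + 2)ab, whence the extra exponent. *)
Lemma pb_add f g : poly_bounded f -> poly_bounded g -> poly_bounded (fun n => f n + g n).
Proof.
move=> [k hk] [l hl]; exists (k + l).+1 => n.
have k0 : 0 < (n + 2) ^ k by rewrite expn_gt0 addn2.
have l0 : 0 < (n + 2) ^ l by rewrite expn_gt0 addn2.
have := hk n; have := hl n; rewrite expnS expnD; nia.
Qed.

Lemma pb_mul f g : poly_bounded f -> poly_bounded g -> poly_bounded (fun n => f n * g n).
Proof.
move=> [k hk] [l hl]; exists (k + l) => n; rewrite expnD; exact: leq_mul.
Qed.

Lemma pb_comp f g : poly_bounded f -> poly_bounded g -> poly_bounded (fun n => f (g n)).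
Proof.
move=> [k hk] pg; have [l hl] := pb_add pg (pb_const 2).
exists (l * k) => n; apply: leq_trans (hk _) _; rewrite expnM.
by case: k {hk} => // k; rewrite leq_exp2r.
Qed.

Lemma pb_vbound e : poly_bounded (vbound e).
Proof.
elim: e => [i||e pe f pf|e pe f pf|e pe f pf|e pe|b e pe|b] //=;
  try exact: pb_id; try exact: pb_const; try exact: pb_add.
apply: pb_mul => //; apply: (pb_comp pf); apply: pb_add => //; exact: pb_id.
Qed.

Lemma pb_tbound e : poly_bounded (tbound e).
Proof.
elim: e => [i||e pe f pf|e pe f pf|e pe f pf|e pe|b e pe|b] //=;
  repeat (apply: pb_add || apply: pb_mul || exact: pb_const || exact: pb_id ||
    exact: pb_vbound || assumption).
all: (apply: (pb_comp pf) || apply: (pb_comp (pb_vbound f)));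
  apply: pb_add; [exact: pb_id | exact: pb_vbound].
Qed.

Lemma eval_vbound w e rho n :
  (forall b, size (w b) <= n) -> all (fun v => v <= n) rho -> eval w e rho <= vbound e n.
Proof.
elim: e rho n => [i||e IHe f IHf|e IHe f IHf|e IHe f IHf|e IHe|b e IHe|b] rho n wn rn //=.
- have [lt|le] := ltnP i (size rho); last by rewrite nth_default.
  exact: (allP rn) (mem_nth _ lt).
- exact: leq_add (IHe _ _ wn rn) (IHf _ _ wn rn).
- exact: leq_trans (leq_subr _ _) (IHe _ _ wn rn).
- have le := IHe _ _ wn rn.
  apply: leq_trans (_ : \sum_(k < eval w e rho) vbound f (n + vbound e n) <= _).
    apply: leq_sum => k _; apply: IHf => [b|/=].
      exact: leq_trans (wn b) (leq_addr _ _).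
    apply/andP; split; first by have := ltn_ord k; lia.
    by apply: sub_all rn => v /= vn; apply: leq_trans vn (leq_addr _ _).
  by rewrite sum_nat_const card_ord leq_mul2r le orbT.
- apply: IHe => //; by case: rho rn => //= v rho /andP[].
- by case: nth.
Qed.

Lemma rstate_eq s s' :
  regs s =1 regs s' -> ipos s =1 ipos s' -> written s = written s' -> s = s'.
Proof.
case: s s' => [f g o] [f' g' o'] /= ef eg ->.
by congr RState; apply: functional_extensionality.
Qed.

Ltac reg_eq := rewrite /= /upd /=; repeat case: eqP => //=; intros; subst; try lia.

Ltac state_eq := apply: rstate_eq => [?|?|] //; reg_eq.

Ltac fresh_state_eq H d := have := H d; have := H d.+1; have := H d.+2;
  have := H d.+3; intros; state_eq.

Section Compile.

Variables (R : nat) (w : bool -> seq bool).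
Notation exec := (@exec R w).

Lemma exec_conv p s n s' m s'' : exec p s n s' -> s' = s'' -> n <= m -> exec p s m s''.
Proof. by move=> e <-; exact: exec_weaken. Qed.

Lemma set_reg_id s r v : regs s r = v -> set_reg s r v = s.
Proof.
case: s => f g o /= <-; congr RState; apply: functional_extensionality => x.
by rewrite /upd; case: eqP => // ->.
Qed.

Lemma set_ipos_id s b v : ipos s b = v -> set_ipos s b v = s.
Proof.
case: s => f g o /= <-; congr RState; apply: functional_extensionality => x.
by rewrite /upd; case: eqP => // ->.
Qed.

Lemma exec_Skip s : exec Skip s 1 s.
Proof.
rewrite -{2}(set_ipos_id (b := false) (erefl _) : _ = s).
apply: (exec_Do_input (b := false)) => t; exact: input_tape_norm.
Qed.

(** [F k] is the state with [k] passes to go; a pass costs [t] for the body and 2 for the test and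
    the decrement. *)
Lemma exec_Loop r p (F : nat -> rstate) n t s s' m :
  r < R -> s = F n -> s' = F 0 -> n * (t + 2) + 1 <= m ->
  (forall k, k <= n -> regs (F k) r = k) ->
  (forall k, k < n -> exec p (set_reg (F k.+1) r k) t (F k)) ->
  exec (Loop r p) s m s'.
Proof.
move=> rR -> -> le Fr Fp; apply: exec_weaken le; elim: n Fr Fp => [|n IH] Fr Fp.
  apply: exec_While_false => T rT; rewrite (tests_counter rR rT) Fr //.
apply: (exec_weaken (n := (1 + t + (n * (t + 2) + 1)).+1)); last by lia.
apply: (exec_While_true (s' := F n)).
- by move=> T rT; rewrite (tests_counter rR rT) Fr.
- by apply: exec_Seq (Fp _ (ltnSn _)); apply: exec_Dec => //; rewrite Fr.
- by apply: IH => k kn; [apply: Fr | apply: Fp]; lia.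
Qed.

Lemma exec_add_reg r a s :
  r < R -> a < R -> r != a ->
  exec (Loop r (Inc a)) s (4 * regs s r + 1)
    (set_reg (set_reg s r 0) a (regs s a + regs s r)).
Proof.
move=> rR aR ra; set A := regs s a; set n := regs s r.
apply: (exec_Loop (t := 2) (n := n)
  (F := fun k => set_reg (set_reg s r k) a (A + (n - k)))) => //.
- by rewrite subnn addn0 [set_reg s r n]set_reg_id // set_reg_id.
- by rewrite subn0.
- lia.
- by move=> k kn; rewrite /= /upd (negPf ra) eqxx.
move=> k kn; apply: exec_conv; [exact: exec_Inc | | by []].
state_eq.
Qed.

Lemma exec_clear r s :
  r < R -> exec (Loop r Skip) s (3 * regs s r + 1) (set_reg s r 0).
Proof.
move=> rR; apply: (exec_Loop (t := 1) (n := regs s r) (F := fun k => set_reg s r k)) => //.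
- by rewrite set_reg_id.
- lia.
- by move=> k _; rewrite /= /upd eqxx.
move=> k kn; apply: exec_conv; [exact: exec_Skip | | by []].
state_eq.
Qed.

Lemma regs_set_reg s r v x : regs (set_reg s r v) x = if x == r then v else regs s x.
Proof. by []. Qed.

Lemma map_set_reg s d v m :
  all (fun r => r < d) m ->
  [seq regs (set_reg s d v) r | r <- m] = [seq regs s r | r <- m].
Proof.
move=> md; apply/eq_in_map => r /(allP md) rd; rewrite regs_set_reg ifN //; lia.
Qed.

Lemma exec_compile e m d s n :
  d + room e <= R -> all (fun r => r < d) m ->
  (forall r, d <= r -> regs s r = 0) -> (forall b, ipos s b = 0) ->
  (forall b, size (w b) <= n) -> all (fun r => regs s r <= n) m ->
  exec (compile e m d) s (tbound e n) (set_reg s d (eval w e [seq regs s r | r <- m])).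
Proof.
elim: e m d s n => [i||e IHe f IHf|e IHe f IHf|e IHe f IHf|e IHe|b e IHe|b] m d s n
  /= dR md s0 p0 wn mn.
- case: ltnP => im; last first.
    rewrite nth_default ?size_map // set_reg_id; last by rewrite s0.
    by apply: exec_weaken; [exact: exec_Skip | lia].
  rewrite (nth_map 0) //; set r := nth 0 m i.
  have rd : r < d by exact: (allP md) (mem_nth _ im).
  have rn : regs s r <= n by exact: (allP mn) (mem_nth _ im).
  move: r rd rn => r rd rn.
  apply: (exec_weaken (n := (regs s r * 6 + 1) + (4 * regs s r + 1))); last by lia.
  (* Reading a register empties it: its value is moved to both [d] and [d.+1], then restored from
     [d.+1]. *)
  apply: (exec_Seq (s' := set_reg (set_reg (set_reg s r 0) d (regs s r)) d.+1 (regs s r))).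
    apply: (exec_Loop (t := 4) (n := regs s r) (F := fun k =>
      set_reg (set_reg (set_reg s r k) d (regs s r - k)) d.+1 (regs s r - k))).
    + lia.
    + rewrite subnn; fresh_state_eq s0 d.
    + by rewrite subn0.
    + lia.
    + move=> k _; reg_eq.
    move=> k kn; apply: exec_conv; first by apply: exec_Seq; apply: exec_Inc; lia.
      fresh_state_eq s0 d.
    by [].
  apply: exec_conv; first by apply: exec_add_reg; lia.
    fresh_state_eq s0 d.
  reg_eq.
- apply: exec_conv; [by apply: exec_Inc; lia | | by []].
  by rewrite s0.
- set v := eval w e _; set u := eval w f _.
  have vn : v <= vbound e n by apply: eval_vbound; rewrite // all_map.
  have un : u <= vbound f n by apply: eval_vbound; rewrite // all_map.
  apply: exec_conv.
  + apply: exec_Seq; first by apply: (IHe _ _ _ n) => //; lia.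
    apply: exec_Seq.
      apply: (IHf _ _ _ n) => //; first by lia.
      * by apply: sub_all md => r /=; lia.
      * by move=> r dr; rewrite regs_set_reg ifN ?s0 //; lia.
      by apply/allP => r rm; rewrite regs_set_reg ifN ?(allP mn) //;
         have := allP md _ rm; lia.
    by apply: exec_add_reg; lia.
  + rewrite map_set_reg // -/u -/v; fresh_state_eq s0 d.
  + rewrite map_set_reg // -/u regs_set_reg eqxx; lia.
- set v := eval w e _; set u := eval w f _.
  have vn : v <= vbound e n by apply: eval_vbound; rewrite // all_map.
  have un : u <= vbound f n by apply: eval_vbound; rewrite // all_map.
  apply: exec_conv.
  + apply: exec_Seq; first by apply: (IHe _ _ _ n) => //; lia.
    apply: exec_Seq.
      apply: (IHf _ _ _ n) => //; first by lia.
      * by apply: sub_all md => r /=; lia.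
      * by move=> r dr; rewrite regs_set_reg ifN ?s0 //; lia.
      by apply/allP => r rm; rewrite regs_set_reg ifN ?(allP mn) //;
         have := allP md _ rm; lia.
    rewrite map_set_reg // -/u -/v.
    apply: (exec_Loop (t := 2) (n := u) (m := 4 * u + 1) (F := fun k =>
        set_reg (set_reg s d (v - (u - k))) d.+1 k)).
    * lia.
    * by rewrite subnn subn0.
    * by [].
    * lia.
    * by move=> k _; rewrite regs_set_reg eqxx.
    move=> k kn; have dR' : d < R by lia.
    (* An empty [d] is left alone, which is truncated subtraction. *)
    apply: (exec_If (c := 0 < v - (u - k.+1))).
      move=> T rT; rewrite (tests_counter dR' rT); reg_eq.
    case: ltnP => lt.
      apply: exec_conv; [apply: (exec_Dec (v := (v - (u - k.+1)).-1)) => // | | by []].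
        reg_eq.
      fresh_state_eq s0 d.
    apply: exec_conv; [exact: exec_Skip | fresh_state_eq s0 d | by []].
  + rewrite subn0; fresh_state_eq s0 d.
  + lia.
- set v := eval w e _; have vn : v <= vbound e n by apply: eval_vbound; rewrite // all_map.
  set n' := n + vbound e n.
  set rho := [seq regs s r | r <- m]; set g := fun k => eval w f (k :: rho).
  have gn k : k < v -> g k <= vbound f n'.
    move=> kv; apply: eval_vbound => [b|]; first by apply: leq_trans (wn b) (leq_addr _ _).
    rewrite /= all_map; apply/andP; split; first by rewrite /n'; lia.
    by apply: sub_all mn => r /= rn; rewrite /n'; lia.
  apply: exec_conv.
  + apply: exec_Seq.
      apply: (IHe _ _ _ n) => //; first by lia.
      * by apply: sub_all md => r /=; lia.
      * by move=> r dr; rewrite s0 //; lia.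
    rewrite -/v; apply: exec_Seq; last first.
      apply: (exec_clear (s := set_reg (set_reg s d (\sum_(k < v) g k)) d.+2 v)); lia.
    (* The counter [d.+1] runs down while the bound variable [d.+2] runs up: with [k] passes to go,
       [d] holds the sum of the first [v - k] terms. *)
    apply: (exec_Loop (t := tbound f n' + (4 * vbound f n' + 1 + 2)) (n := v)
      (m := v * (tbound f n' + 4 * vbound f n' + 5) + 1) (F := fun k => set_reg (set_reg
        (set_reg s d (\sum_(j < v - k) g j)) d.+2 (v - k)) d.+1 k)).
    * lia.
    * rewrite subnn big_ord0; fresh_state_eq s0 d.
    * rewrite subn0; fresh_state_eq s0 d.
    * lia.
    * by move=> k _; rewrite regs_set_reg eqxx.
    move=> k kv.
    have E : eval w f [seq regs (set_reg (set_reg (set_reg (set_reg s d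
          (\sum_(j < v - k.+1) g j)) d.+2 (v - k.+1)) d.+1 k.+1) d.+1 k) r
            | r <- d.+2 :: m] = g (v - k.+1).
      rewrite /g /= /upd; congr (eval _ _ (_ :: _)); first reg_eq.
      by apply/eq_in_map => r /(allP md) rd; reg_eq.
    apply: exec_conv.
    * apply: exec_Seq.
        apply: (IHf _ _ _ n') => //; first by lia.
        - by rewrite /= ltnS leqnn; apply: sub_all md => r /=; lia.
        - by move=> r dr; rewrite !regs_set_reg !ifN ?s0 //; lia.
        - by move=> b; rewrite (leq_trans (wn b)) // leq_addr.
        - rewrite /= /upd /=; apply/andP; split.
            rewrite /n'; reg_eq.
          apply/allP => r rm; have := allP md _ rm; have := allP mn _ rm => rn rd.
          rewrite /n'; reg_eq.
      apply: exec_Seq; first by apply: exec_add_reg; lia.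
      by apply: exec_Inc; lia.
    * rewrite E; have -> : v - k = (v - k.+1).+1 by lia.
      rewrite big_ord_recr /=.
      fresh_state_eq s0 d.
    * rewrite E regs_set_reg eqxx; have := gn (v - k.+1); lia.
  + fresh_state_eq s0 d.
  + rewrite regs_set_reg eqxx -/n'.
    have : v * (tbound f n' + 4 * vbound f n' + 8) <=
           vbound e n * (tbound f n' + 4 * vbound f n' + 8) by rewrite leq_mul2r vn orbT.
    by lia.
- apply: (exec_conv (IHe (behead m) d s n dR _ s0 p0 wn _)) => //.
  + by case: m md {mn} => //= x m /andP[].
  + by case: m mn {md} => //= x m /andP[].
  + by congr (set_reg _ _ (eval _ _ _)); case: m {md mn}.
- set v := eval w e _; have vn : v <= vbound e n by apply: eval_vbound; rewrite // all_map.
  have dR' : d < R by lia.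
  have pb := p0 b.
  apply: exec_conv.
  + apply: exec_Seq.
      apply: (IHe _ _ _ n) => //; first by lia.
      * by apply: sub_all md => r /=; lia.
      * by move=> r dr; rewrite s0 //; lia.
    rewrite -/v; apply: exec_Seq.
      (* [d.+2] remembers how far the head has to walk back once the bit is read. *)
      apply: (exec_Loop (t := 3) (n := v) (m := 5 * v + 1)
        (s' := set_ipos (set_reg s d.+2 v) b v)
        (F := fun k => set_ipos (set_reg (set_reg s d.+1 k) d.+2 (v - k)) b (v - k))).
      * lia.
      * rewrite subnn; fresh_state_eq s0 d.
      * rewrite subn0; fresh_state_eq s0 d.
      * lia.
      * move=> k _; reg_eq.
      move=> k kv; apply: exec_conv.
      * by apply: exec_Seq; [apply: exec_Inc; lia | apply: exec_InRight].
      * fresh_state_eq s0 d.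
      * by [].
    apply: exec_Seq.
      apply: (exec_If (c := nth false (w b) v) (n := 2)
        (s' := set_reg (set_ipos (set_reg s d.+2 v) b v) d (nth false (w b) v))).
        by move=> T rT; rewrite (tests_bit b rT) /= /upd eqxx.
      case: nth; apply: exec_conv; [exact: exec_Inc| | by [] |exact: exec_Skip| | by []].
        fresh_state_eq s0 d.
      fresh_state_eq s0 d.
    apply: (exec_Loop (t := 1) (n := v) (m := 3 * v + 1)
      (F := fun k => set_ipos (set_reg (set_reg s d.+2 k) d (nth false (w b) v)) b k)
      (s' := set_reg s d (nth false (w b) v))).
    * lia.
    * fresh_state_eq s0 d.
    * fresh_state_eq s0 d.
    * lia.
    * move=> k _; reg_eq.
    move=> k kv; apply: exec_conv; [apply: (exec_InLeft (p := k)) | | by []].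
      by rewrite /= /upd eqxx.
    fresh_state_eq s0 d.
  + by [].
  + lia.
- have wbn := wn b; have pb := p0 b; have dR' : d.+1 < R by lia.
  apply: exec_conv.
  + apply: exec_Seq.
      have H k : k <= size (w b) -> exec (While b nonblank (Seq (InRight b) (Seq (Inc d) (Inc d.+1))))
        (set_ipos (set_reg (set_reg s d.+1 (size (w b) - k)) d (size (w b) - k)) b (size (w b) - k))
        (6 * k + 1) (set_ipos (set_reg (set_reg s d.+1 (size (w b))) d (size (w b))) b (size (w b))).
        elim: k => [|k IH] kb.
          rewrite subn0; apply: exec_While_false => T rT.
          by rewrite (tests_input b rT) /= /upd eqxx ltnn.
        apply: (exec_weaken (n := (5 + (6 * k + 1)).+1)); last by lia.
        apply: exec_While_true (IH _); last by lia.
          by move=> T rT; rewrite (tests_input b rT) /= /upd eqxx; lia.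
        apply: exec_conv.
        * by apply: exec_Seq; [apply: exec_InRight | apply: exec_Seq; apply: exec_Inc; lia].
        * fresh_state_eq s0 d.
        * by [].
      have Es : set_ipos (set_reg (set_reg s d.+1 0) d 0) b 0 = s by fresh_state_eq s0 d.
      by have := H _ (leqnn _); rewrite subnn Es; apply.
    apply: (exec_Loop (t := 1) (n := size (w b)) (m := 3 * size (w b) + 1)
      (F := fun k => set_ipos (set_reg (set_reg s d.+1 k) d (size (w b))) b k)
      (s' := set_reg s d (size (w b)))).
    * lia.
    * by [].
    * fresh_state_eq s0 d.
    * lia.
    * move=> k _; reg_eq.
    move=> k kv; apply: exec_conv; [apply: (exec_InLeft (p := k)) | | by []].
      by rewrite /= /upd eqxx.
    fresh_state_eq s0 d.
  + by [].
  + lia.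
Qed.

End Compile.

(** * Machines writing a word given by its length and its bits *)

Definition inputs (x y : seq bool) (b : bool) := if b then y else x.

Definition word_of (e f : expr) (w : bool -> seq bool) : seq bool :=
  mkseq (fun k => eval w f [:: k] != 0) (eval w e [::]).

Definition Write (R : nat) (e f : expr) : prog :=
  Seq (compile e [::] 0)
    (Loop 0 (Seq (compile f [:: 0] 1)
               (Seq (If 3 nonblank (Emit R true) (Emit R false)) (Loop 1 Skip)))).

Definition Write_time e f n :=
  tbound e n +
  vbound e n * (tbound f (n + vbound e n) + 3 * vbound f (n + vbound e n) + 6) + 1.

Lemma room_gt1 e : 1 < room e.
Proof. by elim: e => //=; lia. Qed.

(* Emitting goes leftwards, so the last bit of the word is emitted first. *)
Lemma exec_Write R w e f n :
  (forall b, size (w b) <= n) -> room e + room f < R ->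
  exists2 s, exec R w (Write R e f) start_state (Write_time e f n) s &
    written s = word_of e f w.
Proof.
move=> wn eR; set v := eval w e [::]; set g := fun k => eval w f [:: k].
have vn : v <= vbound e n by exact: eval_vbound.
set n' := n + vbound e n.
have gn k : k < v -> g k <= vbound f n'.
  move=> kv; apply: eval_vbound => [b|]; first by apply: leq_trans (wn b) (leq_addr _ _).
  by rewrite /= andbT /n'; lia.
have R0 : 0 < R by lia.
have R1 : 1 < R by have := room_gt1 f; lia.
set o := word_of e f w; have so : size o = v by rewrite size_mkseq.
exists (RState (fun=> 0) (fun=> 0) o); last by [].
apply: exec_conv.
- apply: exec_Seq; first by apply: (exec_compile (n := n)) => //; lia.
  (* With [k] passes to go, the bits from position [k] on are written; after the decrement, register
     0 is the position of the next bit. *)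
  apply: (exec_Loop (t := tbound f n' + (3 + (3 * vbound f n' + 1))) (n := v)
    (m := v * (tbound f n' + 3 * vbound f n' + 6) + 1)
    (F := fun k => RState (upd (fun=> 0) 0 k) (fun=> 0) (drop k o))).
  + by [].
  + by rewrite drop_oversize ?so.
  + rewrite drop0 //.
  + lia.
  + by [].
  move=> k kv; apply: exec_conv.
  + apply: exec_Seq.
      apply: (exec_compile (n := n')) => //; first by lia.
      * by move=> [].
      * by move=> b; rewrite (leq_trans (wn b)) // leq_addr.
      * by rewrite /= /upd /= andbT /n'; lia.
    rewrite -/(g k); apply: exec_Seq.
      apply: (exec_If (c := g k != 0) (n := 2)).
        by move=> T rT; rewrite (tests_counter R1 rT).
      rewrite -(fun_if (Emit R)); exact: exec_Emit.
    apply: exec_clear => //.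
  + apply: rstate_eq => [[|[|r]]|b|] //=.
    rewrite [RHS](drop_nth false) ?so //; congr (_ :: _).
    by rewrite /o nth_mkseq // -/(g k); case: (_ != _).
  + by rewrite /= /upd /=; have := gn k kv; lia.
- state_eq.
- rewrite /Write_time -/n'.
  have : v * (tbound f n' + 3 * vbound f n' + 6) <=
         vbound e n * (tbound f n' + 3 * vbound f n' + 6) by rewrite leq_mul2r vn orbT.
  by lia.
Qed.

Lemma pb_Write_time e f : poly_bounded (Write_time e f).
Proof.
have ps : poly_bounded (fun n => n + vbound e n).
  by apply: pb_add; [exact: pb_id | exact: pb_vbound].
apply: pb_add; last exact: pb_const.
apply: pb_add; first exact: pb_tbound.
apply: pb_mul; first exact: pb_vbound.
apply: pb_add; last exact: pb_const.
apply: pb_add; first exact: (pb_comp (pb_tbound f)).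
by apply: pb_mul; [exact: pb_const | exact: (pb_comp (pb_vbound f))].
Qed.

Lemma pb_poly f : poly_bounded f -> exists p : {poly nat}, forall n, f n <= p.[n]%R.
Proof.
case=> k h; exists (('X + 2%:P) ^+ k)%R => n; apply: leq_trans (h n) _.
by rewrite horner_exp hornerD hornerX hornerC natrXE.
Qed.

Lemma polytime2_word e f : polytime2 (fun x y => word_of e f (inputs x y)).
Proof.
have [p hp] := pb_poly (pb_Write_time e f).
set R := (room e + room f).+1.
exists (machine_of R.+2 (Write R e f)), p => x y.
have [|s ex <-] := @exec_Write R (inputs x y) e f (size x + size y) _ (ltnSn _).
  by case=> /=; lia.
exact: exec_outputs ex _ (hp _).
Qed.

Lemma polytime1_word e f : polytime1 (fun x => word_of e f (inputs x [::])).
Proof.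
have [p hp] := pb_poly (pb_Write_time e f).
set R := (room e + room f).+1.
exists (machine_of R.+2 (Write R e f)), p => x.
have [|s ex <-] := @exec_Write R (inputs x [::]) e f (size x) _ (ltnSn _).
  by case.
have := exec_outputs ex (hp _); rewrite /outputs_within.
(* An absent second argument and an empty one both leave tape 1 blank. *)
suff -> : init (machine_of R.+2 (Write R e f)) [:: x]
  = init (machine_of R.+2 (Write R e f)) [:: inputs x [::] false; inputs x [::] true] by [].
congr (_, _); apply/ffunP => i; rewrite !ffunE; congr tape_of.
by case: (nat_of_ord i) => [|[|j]] //=; rewrite nth_nil.
Qed.

(** * Computable functions *)

(** One expression serves all inputs and environments; this uniformity is what yields a single
    polynomial-time machine. *)
Definition computable (f : (bool -> seq bool) -> seq nat -> nat) : Prop :=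
  exists e, forall w rho, eval w e rho = f w rho.

Section Computable.

Implicit Types (f g : (bool -> seq bool) -> seq nat -> nat).
Implicit Types (p q r : (bool -> seq bool) -> seq nat -> bool).

Lemma cpt_ext f g : (forall w rho, f w rho = g w rho) -> computable f -> computable g.
Proof. by move=> fg [e he]; exists e => w rho; rewrite he. Qed.

Lemma cpt_var i : computable (fun _ rho => nth 0 rho i).
Proof. by exists (Var i). Qed.

Lemma cpt_add f g :
  computable f -> computable g -> computable (fun w rho => f w rho + g w rho).
Proof. by move=> [e he] [e' he']; exists (Plus e e') => w rho /=; rewrite he he'. Qed.

Lemma cpt_sub f g :
  computable f -> computable g -> computable (fun w rho => f w rho - g w rho).
Proof. by move=> [e he] [e' he']; exists (Minus e e') => w rho /=; rewrite he he'. Qed.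

Lemma cpt_const c : computable (fun _ _ => c).
Proof.
elim: c => [|c IH]; first by exists (Minus One One).
by apply: (cpt_ext _ (cpt_add (ex_intro _ One (fun _ _ => erefl)) IH)) => w rho.
Qed.

Lemma cpt_succ f : computable f -> computable (fun w rho => (f w rho).+1).
Proof.
move=> cf; apply: (cpt_ext _ (cpt_add (cpt_const 1) cf)) => w rho; exact: add1n.
Qed.

Lemma cpt_shift f : computable f -> computable (fun w rho => f w (behead rho)).
Proof. by move=> [e he]; exists (Shift e) => w rho /=; rewrite he. Qed.

Lemma cpt_var1 i : computable (fun _ rho => nth 0 (behead rho) i).
Proof. exact: cpt_shift (cpt_var i). Qed.

Lemma cpt_shift2 f :
  computable f -> computable (fun w rho => f w (behead (behead rho))).
Proof. by move=> cf; exact: cpt_shift (cpt_shift cf). Qed.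

Lemma cpt_shift3 f :
  computable f -> computable (fun w rho => f w (behead (behead (behead rho)))).
Proof. by move=> cf; exact: cpt_shift (cpt_shift2 cf). Qed.

Lemma cpt_var2 i : computable (fun _ rho => nth 0 (behead (behead rho)) i).
Proof. exact: cpt_shift2 (cpt_var i). Qed.

Lemma cpt_var3 i : computable (fun _ rho => nth 0 (behead (behead (behead rho))) i).
Proof. exact: cpt_shift3 (cpt_var i). Qed.

(** Under the binder, [behead rho] is the outer environment and [nth 0 rho 0] the summation
    variable. *)
Lemma cpt_sum f F :
  computable f -> computable (fun w rho => F w (behead rho) (nth 0 rho 0)) ->
  computable (fun w rho => \sum_(k < f w rho) F w rho (val k)).
Proof.
move=> [e he] [e' he']; exists (Sum e e') => w rho /=; rewrite he.
by apply: eq_bigr => k _; rewrite he'.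
Qed.

Lemma cpt_mul f g :
  computable f -> computable g -> computable (fun w rho => f w rho * g w rho).
Proof.
move=> cf cg; apply: (cpt_ext _ (cpt_sum (F := fun w rho _ => g w rho) cf (cpt_shift cg))).
by move=> w rho; rewrite sum_nat_const card_ord.
Qed.

Lemma cpt_bit b f : computable f -> computable (fun w rho => nth false (w b) (f w rho)).
Proof. by move=> [e he]; exists (Bit b e) => w rho /=; rewrite he. Qed.

Lemma cpt_size b : computable (fun w _ => size (w b)).
Proof. by exists (Size b). Qed.

Lemma cpt_leq f g :
  computable f -> computable g -> computable (fun w rho => f w rho <= g w rho).
Proof.
move=> cf cg; apply: (cpt_ext _ (cpt_sub (cpt_const 1) (cpt_sub cf cg))) => w rho.
by lia.
Qed.

Lemma cpt_neg p :
  computable (fun w rho => p w rho) -> computable (fun w rho => ~~ p w rho).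
Proof.
move=> cp; apply: (cpt_ext _ (cpt_sub (cpt_const 1) cp)) => w rho; by case: (p w rho).
Qed.

Lemma cpt_and p q :
  computable (fun w rho => p w rho) -> computable (fun w rho => q w rho) ->
  computable (fun w rho => p w rho && q w rho).
Proof.
move=> cp cq; apply: (cpt_ext _ (cpt_mul cp cq)) => w rho.
by case: (p w rho) (q w rho) => [] [].
Qed.

Lemma cpt_or p q :
  computable (fun w rho => p w rho) -> computable (fun w rho => q w rho) ->
  computable (fun w rho => p w rho || q w rho).
Proof.
move=> cp cq; apply: (cpt_ext _ (cpt_neg (cpt_and (cpt_neg cp) (cpt_neg cq)))) => w rho.
by rewrite -negb_or negbK.
Qed.

Lemma cpt_imp p q :
  computable (fun w rho => p w rho) -> computable (fun w rho => q w rho) ->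
  computable (fun w rho => p w rho ==> q w rho).
Proof.
by move=> cp cq; apply: (cpt_ext _ (cpt_or (cpt_neg cp) cq)) => w rho; rewrite implybE.
Qed.

Lemma cpt_eq f g :
  computable f -> computable g -> computable (fun w rho => f w rho == g w rho).
Proof.
move=> cf cg; apply: (cpt_ext _ (cpt_and (cpt_leq cf cg) (cpt_leq cg cf))) => w rho.
by rewrite -eqn_leq.
Qed.

Lemma cpt_eqb p q :
  computable (fun w rho => p w rho) -> computable (fun w rho => q w rho) ->
  computable (fun w rho => p w rho == q w rho).
Proof.
move=> cp cq; apply: (cpt_ext _ (cpt_eq cp cq)) => w rho.
by case: (p w rho) (q w rho) => [] [].
Qed.

Lemma cpt_if p f g :
  computable (fun w rho => p w rho) -> computable f -> computable g ->
  computable (fun w rho => if p w rho then f w rho else g w rho).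
Proof.
move=> cp cf cg.
apply: (cpt_ext _ (cpt_add (cpt_mul cp cf) (cpt_mul (cpt_neg cp) cg))) => w rho.
by case: (p w rho); rewrite ?(mul1n, mul0n, addn0).
Qed.

Lemma cpt_ifb p q r :
  computable (fun w rho => p w rho) -> computable (fun w rho => q w rho) ->
  computable (fun w rho => r w rho) ->
  computable (fun w rho => if p w rho then q w rho else r w rho).
Proof.
move=> cp cq cr; apply: (cpt_ext _ (cpt_if cp cq cr)) => w rho.
by case: (p w rho).
Qed.

(** For d > 0 the quotient of m by d counts the k < m with (k + 1)d <= m; the guard gives 0 when d =
    0, as [%/] does. *)
Lemma cpt_div f g :
  computable f -> computable g -> computable (fun w rho => f w rho %/ g w rho).
Proof.
move=> cf cg; apply: (cpt_ext (f := fun w rho => \sum_(k < f w rho)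
    ((0 < g w rho) && (k.+1 * g w rho <= f w rho)))) => [w rho|].
  set m := f w rho; set d := g w rho; have [->|d0] := posnP d.
    by rewrite big1 ?divn0.
  have lt : m %/ d <= m by exact: leq_div.
  rewrite (eq_bigr (fun k : 'I_m => if k < m %/ d then 1 else 0)) => [|k _].
    by rewrite -big_mkcond (big_ord_narrow lt) sum_nat_const card_ord muln1.
  by rewrite -leq_divRL //= ; case: (k < _).
apply: (cpt_sum (F := fun w rho k => (0 < g w rho) && (k.+1 * g w rho <= f w rho))) => //.
apply: cpt_and; first exact: (cpt_leq (cpt_const 1) (cpt_shift cg)).
by apply: cpt_leq (cpt_shift cf); apply: cpt_mul (cpt_shift cg); exact/cpt_succ/cpt_var.
Qed.

Lemma cpt_mod f g :
  computable f -> computable g -> computable (fun w rho => f w rho %% g w rho).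
Proof.
move=> cf cg; apply: (cpt_ext _ (cpt_sub cf (cpt_mul (cpt_div cf cg) cg))) => w rho.
by rewrite {1}(divn_eq (f w rho) (g w rho)) addKn.
Qed.

Lemma cpt_all f (P : (bool -> seq bool) -> seq nat -> nat -> bool) :
  computable f -> computable (fun w rho => P w (behead rho) (nth 0 rho 0)) ->
  computable (fun w rho => all (P w rho) (iota 0 (f w rho))).
Proof.
move=> cf cP.
have := cpt_eq (cpt_sum (F := fun w rho k => ~~ P w rho k) cf (cpt_neg cP)) (cpt_const 0).
apply: cpt_ext => w rho; congr nat_of_bool.
rewrite sum_nat_eq0; apply/forallP/allP => [H k|H k].
  by rewrite mem_iota => kf; have := H (Ordinal kf); case: (P _ _ _).
by rewrite H // mem_iota /=.
Qed.

Lemma cpt_has f (P : (bool -> seq bool) -> seq nat -> nat -> bool) :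
  computable f -> computable (fun w rho => P w (behead rho) (nth 0 rho 0)) ->
  computable (fun w rho => has (P w rho) (iota 0 (f w rho))).
Proof.
move=> cf cP; have := cpt_neg (cpt_all (P := fun w rho k => ~~ P w rho k) cf (cpt_neg cP)).
by apply: cpt_ext => w rho; rewrite -has_predC; congr nat_of_bool;
   apply: eq_has => k /=; rewrite negbK.
Qed.

(** The list is fixed outside the expression, so the disjunction is unrolled into it; this is how
    the finite types of a machine enter. *)
Lemma cpt_has_const (T : Type) (s : seq T) (P : (bool -> seq bool) -> seq nat -> pred T) :
  (forall a, computable (fun w rho => P w rho a)) ->
  computable (fun w rho => has (P w rho) s).
Proof.
move=> cP; elim: s => [|a s IH] /=; first exact: cpt_const.
exact: cpt_or.
Qed.

Lemma cpt_poly (p : {poly nat}) f :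
  computable f -> computable (fun w rho => p.[f w rho]%R).
Proof.
move=> cf; rewrite /horner; elim: (polyseq p) => [|a s IH] /=; first exact: cpt_const.
by apply: cpt_add (cpt_const a); exact: cpt_mul.
Qed.

End Computable.

(* Redefined below with the closure lemmas of the functions at hand. *)
Ltac cpt_hook := fail.

Ltac cpt :=
  first [ assumption | exact: cpt_shift | exact: cpt_shift2 | exact: cpt_shift3
  | exact: cpt_const | cpt_hook; cpt | lazymatch goal with
  | |- computable (fun _ _ => nat_of_bool (_ && _)) => apply: cpt_and; cpt
  | |- computable (fun _ _ => nat_of_bool (_ || _)) => apply: cpt_or; cpt
  | |- computable (fun _ _ => nat_of_bool (_ ==> _)) => apply: cpt_imp; cpt
  | |- computable (fun _ _ => nat_of_bool (~~ _)) => apply: cpt_neg; cpt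
  | |- computable (fun _ _ => nat_of_bool (_ <= _)) => apply: cpt_leq; cpt
  | |- computable (fun _ _ => nat_of_bool (@eq_op Datatypes_nat__canonical__eqtype_Equality _ _)) =>
      apply: cpt_eq; cpt
  | |- computable (fun _ _ => nat_of_bool (@eq_op Datatypes_bool__canonical__eqtype_Equality _ _)) =>
      apply: cpt_eqb; cpt
  | |- computable (fun _ _ => nat_of_bool (nth false _ _)) => apply: cpt_bit; cpt
  | |- computable (fun _ _ => nat_of_bool (all _ (iota 0 _))) => apply: cpt_all; cpt
  | |- computable (fun _ _ => nat_of_bool (has _ (iota 0 _))) => apply: cpt_has; cpt
  | |- computable (fun _ _ => (_ + _)%N) => apply: cpt_add; cpt
  | |- computable (fun _ _ => (_ - _)%N) => apply: cpt_sub; cpt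
  | |- computable (fun _ _ => (_ * _)%N) => apply: cpt_mul; cpt
  | |- computable (fun _ _ => _ %/ _) => apply: cpt_div; cpt
  | |- computable (fun _ _ => _ %% _) => apply: cpt_mod; cpt
  | |- computable (fun _ _ => _.+1) => apply: cpt_succ; cpt
  | |- computable (fun _ _ => if _ then _ else _) => apply: cpt_if; cpt
  | |- computable (fun _ _ => nat_of_bool (if _ then _ else _)) => apply: cpt_ifb; cpt
  | |- computable (fun _ _ => size _) => exact: cpt_size
  | |- computable (fun _ rho => nth 0 rho _) => exact: cpt_var
  | |- computable (fun _ rho => nth 0 (behead rho) _) => exact: cpt_var1
  | |- computable (fun _ rho => nth 0 (behead (behead rho)) _) => exact: cpt_var2
  | |- computable (fun _ rho => nth 0 (behead (behead (behead rho))) _) => exact: cpt_var3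
  end | idtac ].

(** * The colouring problem as a problem on adjacency matrices *)

Definition matrix_word (n : nat) (a : nat -> nat -> bool) : seq bool :=
  nseq n true ++ false :: [seq a i j | i <- iota 0 n, j <- iota 0 n].

Definition graph_matrix (n : nat) (a : nat -> nat -> bool) : Prop :=
  forall i j, i < n -> j < n -> a i j = a j i /\ ~~ a i i.

(* [c i j] is only relevant for [i < j]. *)
Definition one_in_triangles (n : nat) (a c : nat -> nat -> bool) : Prop :=
  forall i j k, i < j -> j < k -> k < n -> a i j -> a j k -> a i k ->
    c i j + c j k + c i k = 1.

Definition o0 : 'I_3 := ord0.
Definition o1 : 'I_3 := Ordinal (isT : 1 < 3).
Definition o2 : 'I_3 := Ordinal (isT : 2 < 3).

Lemma ord3P (i : 'I_3) : [\/ i = o0, i = o1 | i = o2].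
Proof.
by case: i => [[|[|[|i]]] lti] //;
  [apply: Or31 | apply: Or32 | apply: Or33]; apply: val_inj.
Qed.

(** An induced coloured triangle amounts to an ordered triple of pairwise adjacent vertices,
    distinct by irreflexivity; this disposes of subsets and isomorphisms. *)
Lemma induced_K3 (K : cgraph) (h : {set K3} -> colour) :
  (exists S : {set K}, cgraph_iso (induced S) (@CGraph K3 h)) <->
  (exists x y z : K, [/\ [/\ adj x y, adj x z & adj y z],
     ecol [set x; y] = h [set o0; o1], ecol [set x; z] = h [set o0; o2]
     & ecol [set y; z] = h [set o1; o2]]).
Proof.
split=> [[S [f [[g fK gK] fadj fcol]]]|[x [y [z [[xy xz yz] cxy cxz cyz]]]]].
  have A u v : u != v -> adj (val (g u)) (val (g v)).
    by move=> uv; have := fadj (g u) (g v); rewrite !gK /= uv.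
  have C u v : u != v -> ecol [set val (g u); val (g v)] = h [set u; v].
    move=> uv; have := fcol (g u) (g v) (A _ _ uv); rewrite !gK /= => ->.
    by rewrite imsetU !imset_set1.
  by exists (val (g o0)), (val (g o1)), (val (g o2)); rewrite !A ?C.
have nxy : (x == y) = false by apply: contraTF xy => /eqP->; rewrite adj_irr.
have nxz : (x == z) = false by apply: contraTF xz => /eqP->; rewrite adj_irr.
have nyz : (y == z) = false by apply: contraTF yz => /eqP->; rewrite adj_irr.
set S := [set x; y; z]; exists S.
have xS : x \in S by rewrite !inE eqxx.
have yS : y \in S by rewrite !inE eqxx orbT.
have zS : z \in S by rewrite !inE eqxx !orbT.
pose T := {u : K | u \in S}.
pose g (i : 'I_3) : T := if i == o0 then Sub x xS else if i == o1 then Sub y yS else Sub z zS.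
pose f (u : T) : 'I_3 := if val u == x then o0 else if val u == y then o1 else o2.
have gK : cancel g f.
  by move=> i; case: (ord3P i) => ->; rewrite /g /f /= ?eqxx // 1?eq_sym ?nxy //
     1?[z == x]eq_sym ?nxz // 1?[z == y]eq_sym ?nyz.
have fK : cancel f g.
  case=> u uS; apply: val_inj; rewrite /f /g /=.
  by move: uS; rewrite !inE => /orP[/orP[]|] /eqP->;
     rewrite ?eqxx // 1?[y == x]eq_sym ?nxy ?eqxx // 1?[z == x]eq_sym ?nxz // 1?[z == y]eq_sym ?nyz.
have gadj i j : adj (val (g i)) (val (g j)) = (i != j).
  by case: (ord3P i) (ord3P j) => -> [] -> /=;
    rewrite ?adj_irr ?xy ?xz ?yz // adj_sym ?xy ?xz ?yz.
have gcol i j : i != j -> ecol [set val (g i); val (g j)] = h [set i; j].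
  by case: (ord3P i) (ord3P j) => -> [] -> //= _; rewrite ?cxy ?cxz ?cyz //;
    rewrite setUC ?cxy ?cxz ?cyz // setUC.
exists f; split; first by exists g.
- by move=> u v; rewrite -{2}[u]fK -{2}[v]fK /= gadj.
- move=> u v; rewrite -[u]fK -[v]fK !gK /= gadj => uv.
  by rewrite imsetU !imset_set1 /= gcol.
Qed.

(* In [triangle_family b] the allowed triangles are those with exactly one edge of the
   special colour: red for [b = true], blue for [b = false]. *)
Definition triangle_family (b : bool) : cfamily :=
  if b then cfamily3 bK3 rK3 rrbK3 else cfamily3 bK3 rK3 rbbK3.

Definition special (b : bool) (c : colour) : bool := if c is Red then b else ~~ b.

Definition special_colour (b v : bool) : colour := if v == b then Red else Blue.

Lemma special_colourK b : cancel (special_colour b) (special b).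
Proof. by case: b => [] []. Qed.

Lemma triangle_free b (G : graph) (c : colouring G) :
  is_free (triangle_family b) (CGraph c) <->
  forall x y z : G, adj x y -> adj x z -> adj y z ->
    special b (c [set x; y]) + special b (c [set x; z]) + special b (c [set y; z]) = 1.
Proof.
have Kind (h : {set K3} -> colour) (x y z : G) : is_free (triangle_family b) (CGraph c) ->
    triangle_family b (@CGraph K3 h) -> adj x y -> adj x z -> adj y z ->
    ~ [/\ c [set x; y] = h [set o0; o1], c [set x; z] = h [set o0; o2]
        & c [set y; z] = h [set o1; o2]].
  move=> free Fh xy xz yz [e1 e2 e3].
  have [S iso] : exists S : {set CGraph c}, cgraph_iso (induced S) (@CGraph K3 h).
    by apply/induced_K3; exists x, y, z; split.
  exact: free Fh iso.
have Fb : triangle_family b bK3 by rewrite /triangle_family; case: (b); apply: Or31.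
have Fr : triangle_family b rK3 by rewrite /triangle_family; case: (b); apply: Or32.
have F3 : triangle_family b (if b then rrbK3 else rbbK3)
  by rewrite /triangle_family; case: (b); apply: Or33.
split=> [free x y z xy xz yz|one S H FH iso].
  have := Kind _ x y z free Fb xy xz yz; have := Kind _ x y z free Fr xy xz yz.
  (* The odd edge of the mixed triangle, the one avoiding vertex 0, can be any of the three edges;
     hence three orders of the vertices. *)
  move: F3 {Fb Fr}; rewrite /rrbK3 /rbbK3; case: b Kind free => Kind free F3;
  have := Kind _ x y z free F3 xy xz yz; rewrite adj_sym in xy;
  have := Kind _ y x z free F3 xy yz xz; rewrite adj_sym in xz; rewrite adj_sym in yz;
  rewrite adj_sym in xy; have := Kind _ z x y free F3 xz yz xy;
  rewrite !inE /= ![[set y; x]]setUC ![[set z; _]]setUC;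
  case: (c [set x; y]); case: (c [set x; z]); case: (c [set y; z]) => //=;
  do ?[by case=> //|by move=> ? [] // | by move=> ? ? [] | by move=> ? ? ? [] | by move=> ? ? ? ? []].
have [h [EH hP]] : exists h, H = @CGraph K3 h /\
    special b (h [set o0; o1]) + special b (h [set o0; o2]) + special b (h [set o1; o2]) != 1.
  move: FH; rewrite /triangle_family; case: (b) => -[] ->; eexists; split=> //=; by rewrite !inE.
subst H.
have : exists S : {set CGraph c}, cgraph_iso (induced S) (@CGraph K3 h) by exists S.
move/induced_K3=> [x [y [z [[xy xz yz] e1 e2 e3]]]].
by move: hP; rewrite -e1 -e2 -e3 /= one.
Qed.

Definition rank_lift (T : finType) (r : T -> T -> bool) (i j : nat) : bool :=
  [exists u, exists v, [&& enum_rank u == i :> nat, enum_rank v == j :> nat & r u v]].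

Lemma rank_liftE (T : finType) (r : T -> T -> bool) u v :
  rank_lift r (enum_rank u) (enum_rank v) = r u v.
Proof.
apply/existsP/idP => [[u' /existsP[v' /and3P[/eqP eu /eqP ev]]]|ruv].
  by rewrite (enum_rank_inj (val_inj eu)) (enum_rank_inj (val_inj ev)).
by exists u; apply/existsP; exists v; rewrite !eqxx.
Qed.

Lemma rankP (T : finType) i : i < #|T| -> exists u : T, enum_rank u = i :> nat.
Proof. by move=> iT; exists (enum_val (Ordinal iT)); rewrite enum_valK. Qed.

Lemma iota_rank (T : finType) : iota 0 #|T| = [seq val (enum_rank x) | x <- enum T].
Proof.
apply: (eq_from_nth (x0 := 0)) => [|i]; rewrite size_iota; first by rewrite size_map -cardE.
move=> iT; have [x _] := rankP iT.
rewrite nth_iota // (nth_map x) -?cardE // add0n.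
by rewrite -[i]/(val (Ordinal iT)) -enum_val_nth enum_valK.
Qed.

Lemma encode_matrix (G : graph) : encode G = matrix_word #|G| (rank_lift (@adj G)).
Proof.
rewrite /encode /matrix_word iota_rank allpairs_mapl allpairs_mapr.
by congr (_ ++ _ :: _); apply: eq_allpairs => x y /=; rewrite rank_liftE.
Qed.

Lemma allpairs_iota (a : nat -> nat -> bool) m n :
  [seq a i j | i <- iota 0 m, j <- iota 0 n] =
  [seq a (k %/ n) (k %% n) | k <- iota 0 (m * n)].
Proof.
elim: m => [|m IH]; first by rewrite mul0n.
rewrite -addn1 iotaD allpairs_cat IH mulnDl mul1n iotaD map_cat add0n /= cats0.
congr (_ ++ _); rewrite add0n -[m * n]addn0 iotaDl -map_comp.
apply/eq_in_map => j; rewrite mem_iota /= => jn.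
by rewrite divnMDl ?modnMDl ?divn_small ?modn_small ?addn0; lia.
Qed.

(** The closed formula by which an expression computes the word. *)
Definition matrix_bit n a k :=
  if k < n then true else if k == n then false else a ((k - n.+1) %/ n) ((k - n.+1) %% n).

Lemma matrix_word_mkseq n a :
  matrix_word n a = mkseq (matrix_bit n a) (n + (n * n).+1).
Proof.
rewrite /matrix_word allpairs_iota /mkseq iotaD map_cat add0n /=; congr (_ ++ _).
  apply: (eq_from_nth (x0 := false)) => [|i]; rewrite size_nseq ?size_map ?size_iota // => lt.
  by rewrite (nth_map 0) ?size_iota // nth_iota // nth_nseq lt /matrix_bit lt.
rewrite /matrix_bit ltnn eqxx; congr cons; rewrite -[n.+1]addn0 iotaDl -map_comp.
apply/eq_in_map => j _ /=; rewrite addn0.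
by rewrite ifN ?ifN ?addKn //; lia.
Qed.

Lemma nth_matrix_word n a i j :
  i < n -> j < n -> nth false (matrix_word n a) (n.+1 + i * n + j) = a i j.
Proof.
move=> lin ljn; rewrite matrix_word_mkseq nth_mkseq; last by nia.
rewrite /matrix_bit ifN ?ifN; try by nia.
have -> : n.+1 + i * n + j - n.+1 = i * n + j by lia.
by rewrite divnMDl ?modnMDl ?divn_small ?modn_small ?addn0; lia.
Qed.

(** The length [n + n * n + 1] determines [n], and then positions determine entries. *)
Lemma matrix_word_inj n a n' a' :
  matrix_word n a = matrix_word n' a' ->
  n = n' /\ forall i j, i < n -> j < n -> a i j = a' i j.
Proof.
move=> E; have en : n = n'.
  have := congr1 size E; rewrite !matrix_word_mkseq !size_mkseq; nia.
split=> // i j il jl; rewrite -(nth_matrix_word a il jl) E en.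
by rewrite nth_matrix_word -?en.
Qed.

Lemma triangle_problem b w :
  free_colouring_problem (triangle_family b) w <->
  exists n a c, [/\ w = matrix_word n a, graph_matrix n a & one_in_triangles n a c].
Proof.
split=> [[G [[c /triangle_free free] <-]]|[n [a [c [-> am cP]]]]].
  exists #|G|, (rank_lift (@adj G)), (rank_lift (fun u v => special b (c [set u; v]))).
  split; first exact: encode_matrix.
    move=> i j iN jN; have [[u <-] [v <-]] := (rankP iN, rankP jN).
    rewrite !rank_liftE; split; first exact: adj_sym.
    by rewrite adj_irr.
  move=> i j k ij jk kn; have jn := ltn_trans jk kn; have iN := ltn_trans ij jn.
  have [[[x <-] [y <-]] [z <-]] := (rankP iN, rankP jn, rankP kn).
  by rewrite !rank_liftE => xy yz xz; rewrite -(free x y z) //; lia.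
have symm : symmetric (fun i j : 'I_n => a i j) by move=> i j; have [] := am i j.
have irr : irreflexive (fun i j : 'I_n => a i j).
  by move=> i; have [_ /negPf] := am i i (ltn_ord i) (ltn_ord i).
pose G := Graph symm irr.
(* A colouring is defined on sets: an edge gets the value of [c] at its increasing pair of ends. *)
pose col : colouring G := fun e =>
  special_colour b [exists i : 'I_n, exists j : 'I_n, [&& i < j, e == [set i; j] & c i j]].
have colE (i j : 'I_n) : i < j -> special b (col [set i; j]) = c i j.
  move=> ij; rewrite special_colourK; apply/existsP/idP => [[i' /existsP[j' /and3P[ij']]]|cij].
    move=> /eqP E; suff [-> ->] : i = i' /\ j = j' by [].
    have : i \in [set i'; j'] by rewrite -E !inE eqxx.
    have : j \in [set i'; j'] by rewrite -E !inE eqxx orbT.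
    rewrite !inE => /orP[] /eqP ej /orP[] /eqP ei; subst => //; lia.
  by exists i; apply/existsP; exists j; rewrite ij eqxx.
exists G; split; last first.
  by rewrite /encode /matrix_word /G /= -val_enum_ord allpairs_mapl allpairs_mapr card_ord.
exists col; apply/triangle_free.
pose s (x y : 'I_n) : nat := special b (col [set x; y]).
have sC x y : s x y = s y x by rewrite /s setUC.
have sP (x y z : 'I_n) : x < y -> y < z -> a x y -> a x z -> a y z ->
    s x y + s x z + s y z = 1.
  move=> xy yz axy axz ayz; rewrite /s !colE //; last exact: ltn_trans yz.
  by rewrite -(cP x y z) //; lia.
move=> x y z /= xy xz yz; rewrite -/(s x y) -/(s x z) -/(s y z).
have neq (u v : 'I_n) : a u v -> (u : nat) <> v.
  by move=> auv uv; have := irr v; rewrite -[X in a X _]uv auv.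
have aC (u v : 'I_n) : a u v = a v u by exact: symm.
have := (neq _ _ xy, neq _ _ xz, neq _ _ yz) => -[[nxy nxz] nyz].
have [lxy|lyx|] := ltngtP x y; last by [].
  have [lyz|lzy|] := ltngtP y z; [exact: sP| |by []].
  have [lxz|lzx|] := ltngtP x z; last by [].
    by have := sP x z y lxz lzy; rewrite (aC z y) (sC z y) => <- //; lia.
  by have := sP z x y lzx lxy; rewrite (aC z y) (aC z x) (sC z y) (sC z x) => <- //; lia.
have [lxz|lzx|] := ltngtP x z; last by [].
  by have := sP y x z lyx lxz; rewrite (aC y x) (sC y x) => <- //; lia.
have [lyz|lzy|] := ltngtP y z; last by [].
  by have := sP y z x lyz lzx; rewrite (aC y x) (aC z x) (sC y x) (sC z x) => <- //; lia.
have := sP z y x lzy lyx.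
by rewrite (aC z y) (aC z x) (aC y x) (sC z y) (sC z x) (sC y x) => <- //; lia.
Qed.

Lemma triangle_problem_matrix b n a :
  graph_matrix n a ->
  free_colouring_problem (triangle_family b) (matrix_word n a) <-> exists c, one_in_triangles n a c.
Proof.
move=> am; rewrite triangle_problem; split=> [[n' [a' [c [/matrix_word_inj[<- E] am' cP]]]]|[c cP]].
  exists c => i j k ij jk kn; rewrite !E; try lia; exact: cP.
by exists n, a, c.
Qed.

(** * Membership in NP *)

Lemma computable_word f g : computable f -> computable g ->
  exists e e', forall w, word_of e e' w = mkseq (fun k => g w [:: k] != 0) (f w [::]).
Proof.
move=> [e he] [e' he']; exists e, e' => w; rewrite /word_of he.
by apply: eq_map => k; rewrite he'.
Qed.

Lemma polytime2_pred (V : (bool -> seq bool) -> bool) :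
  computable (fun w _ => V w) -> polytime2 (fun x y => [:: V (inputs x y)]).
Proof.
move=> cV; have [e [e' E]] := computable_word (cpt_const 1) cV.
have [M [p Mp]] := polytime2_word e e'; exists M, p => x y.
by have := Mp x y; rewrite E /=; case: (V _).
Qed.

Lemma polytime1_mkseq (n : seq bool -> nat) (g : seq bool -> nat -> bool) :
  computable (fun w _ => n (w false)) ->
  computable (fun w rho => g (w false) (nth 0 rho 0)) ->
  polytime1 (fun x => mkseq (g x) (n x)).
Proof.
move=> cn cg; have [e [e' E]] := computable_word cn cg.
have [M [p Mp]] := polytime1_word e e'; exists M, p => x.
have := Mp x; rewrite E /=; congr (outputs_within _ _ _).
by apply: eq_map => k; case: (g x k).
Qed.

(* x is the word of a graph, y lists the colours c i j at position i * n + j. *)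
Definition checks (x y : seq bool) : bool :=
  let a n i j := nth false x (n.+1 + i * n + j) in
  let c n i j := nth false y (i * n + j) in
  has (fun n => [&& size x == n + (n * n).+1,
    all (fun i => nth false x i) (iota 0 n), ~~ nth false x n,
    all (fun i => all (fun j => (a n i j == a n j i) && ~~ a n i i) (iota 0 n)) (iota 0 n)
  & all (fun k => all (fun j => all (fun i =>
      [&& a n i j, a n j k & a n i k] ==> (c n i j + c n j k + c n i k == 1))
    (iota 0 j)) (iota 0 k)) (iota 0 n)]) (iota 0 (size x)).

Lemma computable_checks : computable (fun w _ => checks (w false) (w true)).
Proof. rewrite /checks; cpt. Qed.

Lemma all_iota (P : pred nat) n : reflect (forall i, i < n -> P i) (all P (iota 0 n)).
Proof.
by apply: (iffP allP) => H i; have := H i; rewrite mem_iota.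
Qed.

Lemma triangle_problem_in_NP b : in_NP (free_colouring_problem (triangle_family b)).
Proof.
(* The matrix of colours has n * n bits, fewer than the word of the graph, so the identity
   polynomial bounds the certificate. *)
exists checks, 'X%R; split.
  have [M [p Mp]] := polytime2_pred (V := fun w => checks (w false) (w true)) computable_checks.
  by exists M, p.
move=> x; rewrite triangle_problem hornerX; split=> [[n [a [c [-> am cP]]]]|[y [_ /hasP[n _]]]].
  have Ea i j : i < n -> j < n -> nth false (matrix_word n a) (n.+1 + i * n + j) = a i j.
    exact: nth_matrix_word.
  have sz : size (matrix_word n a) = n + (n * n).+1 by rewrite matrix_word_mkseq size_mkseq.
  pose y := mkseq (fun k => c (k %/ n) (k %% n)) (n * n).
  have Ey i j : i < n -> j < n -> nth false y (i * n + j) = c i j.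
    move=> lin ljn; rewrite nth_mkseq; last by nia.
    by rewrite divnMDl ?modnMDl ?divn_small ?modn_small ?addn0; lia.
  exists y; split; first by rewrite size_mkseq sz; lia.
  apply/hasP; exists n; first by rewrite mem_iota sz; lia.
  rewrite sz eqxx /=; apply/and4P; split.
  - apply/all_iota => i iN; rewrite matrix_word_mkseq nth_mkseq ?/matrix_bit ?iN //; lia.
  - by rewrite matrix_word_mkseq nth_mkseq /matrix_bit ?ltnn ?eqxx //; lia.
  - apply/all_iota => i iN; apply/all_iota => j jN; rewrite !Ea //.
    by have [-> ->] := am i j iN jN; rewrite eqxx.
  - apply/all_iota => k kn; apply/all_iota => j jk; apply/all_iota => i ij.
    have jn := ltn_trans jk kn; have lin := ltn_trans ij jn; rewrite !Ea // !Ey //.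
    by apply/implyP => /and3P[*]; rewrite cP.
move=> /and5P[/eqP sz /all_iota x1 x0 /all_iota xa /all_iota xc].
exists n, (fun i j => nth false x (n.+1 + i * n + j)), (fun i j => nth false y (i * n + j)).
split.
- rewrite matrix_word_mkseq; apply: (eq_from_nth (x0 := false)); rewrite ?size_mkseq // => k.
  rewrite sz => kn; rewrite nth_mkseq // /matrix_bit; case: ltnP => [/x1 //|nk].
  case: eqP => [->|kn']; first exact: negbTE.
  by rewrite -addnA -divn_eq subnKC //; lia.
- move=> i j iN jN; have /all_iota/(_ j jN)/andP[/eqP ? ?] := xa i iN; by [].
- move=> i j k ij jk kn xij xjk xik.
  have /all_iota/(_ _ jk)/all_iota/(_ _ ij) := xc k kn.
  by rewrite xij xjk xik => /eqP.
Qed.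

(** * From 1-in-3 satisfiability to triangles *)

(** With a symmetric colouring, triangles may be taken in any order of their vertices, as the
    analysis of the gadget requires. *)
Lemma one_in_triangles_sym n a :
  graph_matrix n a ->
  (exists c, one_in_triangles n a c) <->
  (exists c : nat -> nat -> bool, (forall u v, c u v = c v u) /\
     forall u v w, u < n -> v < n -> w < n -> a u v -> a v w -> a u w ->
       c u v + c v w + c u w = 1).
Proof.
move=> am; split=> [[c cP]|[c [_ cP]]]; last first.
  by exists c => i j k ij jk kn; apply: cP; lia.
pose d u v : bool := if u < v then c u v else c v u.
have dC u v : u <> v -> d u v = d v u.
  by rewrite /d; case: ltngtP.
have aC u v : u < n -> v < n -> a u v = a v u by move=> un vn; have [] := am u v un vn.
have dP u v w : u < v -> v < w -> w < n -> a u v -> a v w -> a u w ->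
    d u v + d v w + d u w = 1.
  move=> uv vw wn auv avw auw; have uw := ltn_trans uv vw.
  by rewrite /d uv vw uw; exact: cP.
exists (fun u v => if u == v then false else d u v); split.
  move=> u v; rewrite [v == u]eq_sym; case: eqP => // /dC; exact.
move=> u v w un vn wn auv avw auw.
have neq x y : x < n -> y < n -> a x y -> (x == y) = false.
  by move=> xn yn axy; apply: contraTF axy => /eqP->; have [] := am y y yn yn.
rewrite !neq //; have := (neq _ _ un vn auv, neq _ _ vn wn avw, neq _ _ un wn auw).
case=> [[nuv nvw] nuw].
have dC' x y : (x == y) = false -> d x y = d y x by move/eqP; exact: dC.
have [[Evu Ewv] Ewu] := (dC' _ _ nuv, dC' _ _ nvw, dC' _ _ nuw).
have [avu awv awu] : [/\ a v u, a w v & a w u] by rewrite (aC v u) // (aC w v) // (aC w u).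
have [lxy|lyx|E] := ltngtP u v; last by rewrite E eqxx in nuv.
  have [lyz|lzy|E] := ltngtP v w; [exact: dP| |by rewrite E eqxx in nvw].
  have [lxz|lzx|E] := ltngtP u w; last by rewrite E eqxx in nuw.
    by rewrite -(dP u w v) // Ewv addnAC; clear; lia.
  by rewrite -(dP w u v) // Ewv Ewu; clear; lia.
have [lxz|lzx|E] := ltngtP u w; last by rewrite E eqxx in nuw.
  by rewrite -(dP v u w) // Evu; clear; lia.
have [lyz|lzy|E] := ltngtP v w; last by rewrite E eqxx in nvw.
  by rewrite -(dP v w u) // Evu Ewu; clear; lia.
by rewrite -(dP w v u) // Evu Ewv Ewu; clear; lia.
Qed.

Section OneInThree.

Variables (m : nat) (lit : nat -> nat -> nat).

Hypothesis lit_lt : forall b k, b < m -> lit b k < m.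
Hypothesis lit_neq : forall b,
  [/\ lit b 0 <> lit b 1, lit b 0 <> lit b 2 & lit b 1 <> lit b 2].

Definition one_in_three (g : nat -> bool) : Prop :=
  forall b, b < m -> g (lit b 0) + g (lit b 1) + g (lit b 2) = 1.

(** Vertex [k + 2] is opposite to the edge standing for [lit b k], so it is the vertex of the
    triangle left out of the K4 of that variable. *)
Definition link b x r :=
  [|| (r != 2) && (lit b 0 == x), (r != 3) && (lit b 1 == x) | (r != 4) && (lit b 2 == x)].

(* The vertex 5 b + r is, for r < 2, an end of the edge of variable b, and
   otherwise a vertex of the triangle of constraint b; the edge opposite to vertex
   5 b + k + 2 of that triangle and the edge of variable [lit b k] span a K4. *)
Definition gadget u v : bool :=
  if u %% 5 < 2 then
    if v %% 5 < 2 then (u %/ 5 == v %/ 5) && (u %% 5 != v %% 5)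
    else link (v %/ 5) (u %/ 5) (v %% 5)
  else
    if v %% 5 < 2 then link (u %/ 5) (v %/ 5) (u %% 5)
    else (u %/ 5 == v %/ 5) && (u %% 5 != v %% 5).

Lemma gadget_sym u v : gadget u v = gadget v u.
Proof.
by rewrite /gadget [v %/ 5 == _]eq_sym [v %% 5 == _]eq_sym; do 2 case: ifP.
Qed.

Lemma gadget_matrix n : graph_matrix n gadget.
Proof.
move=> u v _ _; split; first exact: gadget_sym.
by rewrite /gadget; case: (u %% 5 < 2); rewrite !eqxx andbF.
Qed.

Lemma gadget_block b r r' : r < 5 -> r' < 5 -> r != r' -> (r < 2) = (r' < 2) ->
  gadget (b * 5 + r) (b * 5 + r').
Proof.
move=> r5 r'5 rr' E.
rewrite /gadget !divnMDl // !modnMDl !divn_small // !modn_small // !addn0.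
by rewrite E eqxx rr'; case: (r' < 2).
Qed.

Lemma gadget_link b x r r' : r < 5 -> r' < 2 -> 1 < r -> link b x r ->
  gadget (b * 5 + r) (x * 5 + r').
Proof.
move=> r5 r'2 r1 l; have r'5 : r' < 5 by lia.
rewrite /gadget !divnMDl // !modnMDl !divn_small // !modn_small // !addn0 l r'2.
by rewrite ltnNge r1.
Qed.

Section ColouringOfAssignment.
Variable g : nat -> bool.

(* The ends of the edge of block b that is opposite to variable x in their K4; when
   that edge is not special, the special matching of the K4 is chosen to join [lo]
   to the first end of the edge of x and [hi] to the second one. *)
Definition lo b x := if lit b 0 == x then 3 else 2.
Definition hi b x := if lit b 2 == x then 3 else 4.

Definition cross b x s r : bool := ~~ g x && (r == if s == 0 then lo b x else hi b x).

Definition inner b r r' : bool :=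
  if (r != 2) && (r' != 2) then g (lit b 0)
  else if (r != 3) && (r' != 3) then g (lit b 1) else g (lit b 2).

Definition gadget_colour u v : bool :=
  if u %% 5 < 2 then
    if v %% 5 < 2 then g (minn (u %/ 5) (v %/ 5))
    else cross (v %/ 5) (u %/ 5) (u %% 5) (v %% 5)
  else
    if v %% 5 < 2 then cross (u %/ 5) (v %/ 5) (v %% 5) (u %% 5)
    else inner (minn (u %/ 5) (v %/ 5)) (u %% 5) (v %% 5).

Lemma gadget_colour_sym u v : gadget_colour u v = gadget_colour v u.
Proof.
by rewrite /gadget_colour /inner minnC ![(v %% 5 != _) && _]andbC; do 2 case: ifP.
Qed.

(** As the three variables differ, x is [lit b k] for a single k, and the linked vertices are the
    two ends of the edge opposite to vertex k + 2. *)
Lemma linkP b x r : 1 < r < 5 -> link b x r ->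
  [/\ r = lo b x \/ r = hi b x, lo b x != hi b x, 1 < lo b x, 1 < hi b x &
      forall r', r != r' -> (r' = lo b x \/ r' = hi b x) -> inner b r r' = g x].
Proof.
have [n01 n02 n12] := lit_neq b.
have dich r0 : 1 < r0 < 5 -> [\/ r0 = 2, r0 = 3 | r0 = 4].
  by case: r0 => [|[|[|[|[|]]]]] // _; [apply: Or31 | apply: Or32 | apply: Or33].
rewrite /link /lo /hi => r5.
have [e0|n0] := eqVneq (lit b 0) x.
  have -> : (lit b 1 == x) = false by lia.
  have -> : (lit b 2 == x) = false by lia.
  rewrite andbT !andbF !orbF => nr; split=> //; first by lia.
  by move=> r' rr' rP; rewrite /inner nr ifT ?e0 //; lia.
rewrite andbF /=; have [e1|n1] := eqVneq (lit b 1) x.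
  have -> : (lit b 2 == x) = false by lia.
  rewrite andbT andbF orbF => nr; split=> //; first by lia.
  by move=> r' rr' rP; rewrite /inner ifN ?ifT ?e1 //; lia.
rewrite andbF /=; have [e2|n2] := eqVneq (lit b 2) x; last by rewrite andbF.
rewrite andbT => nr; split=> //; first by lia.
by move=> r' rr' rP; rewrite /inner ifN ?ifN ?e2 //; lia.
Qed.

(** A triangle consists of both ends of a variable edge and a linked vertex ([P1]), of one end and
    two linked vertices ([P2]), or of the three vertices of a constraint. The first two lie in a K4
    coloured by a perfect matching; the last is the 1-in-3 condition. *)
Lemma gadget_colourP :
  one_in_three g ->
  forall u v w, u < m * 5 -> v < m * 5 -> w < m * 5 ->
    gadget u v -> gadget v w -> gadget u w ->
    gadget_colour u v + gadget_colour v w + gadget_colour u w = 1.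
Proof.
move=> gP.
have P1 u v w : u %% 5 < 2 -> v %% 5 < 2 -> ~~ (w %% 5 < 2) ->
    gadget u v -> gadget v w -> gadget u w ->
    gadget_colour u v + gadget_colour v w + gadget_colour u w = 1.
  rewrite /gadget /gadget_colour => ur vr wr; rewrite ur vr (negPf wr).
  move=> /andP[/eqP <- nr]; rewrite minnn => /linkP[|rP nl _ _ _ _].
    by have := ltn_pmod w (isT : 0 < 5); lia.
  rewrite /cross; case: (g _) => //=.
  have [[-> ->]|[-> ->]] : (u %% 5 = 0 /\ v %% 5 = 1) \/ (u %% 5 = 1 /\ v %% 5 = 0) by lia.
    by rewrite /=; case: rP => ->; rewrite eqxx ?[hi _ _ == _]eq_sym (negPf nl).
  by rewrite /=; case: rP => ->; rewrite eqxx ?[hi _ _ == _]eq_sym (negPf nl).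
have P2 u v w : u %% 5 < 2 -> ~~ (v %% 5 < 2) -> ~~ (w %% 5 < 2) ->
    gadget u v -> gadget v w -> gadget u w ->
    gadget_colour u v + gadget_colour v w + gadget_colour u w = 1.
  rewrite /gadget /gadget_colour => ur vr wr; rewrite ur (negPf vr) (negPf wr).
  move=> l /andP[/eqP E nr]; rewrite -E minnn.
  have vr5 : 1 < v %% 5 < 5 by have := ltn_pmod v (isT : 0 < 5); lia.
  have wr5 : 1 < w %% 5 < 5 by have := ltn_pmod w (isT : 0 < 5); lia.
  case/(linkP wr5) => wP nl lo1 hi1 _; case/(linkP vr5): l => vP _ _ _ /(_ _ nr wP) ->.
  rewrite /cross; case: (g _) => //=; case: ifP => _; move: nr nl;
  by case: wP => ->; case: vP => ->; rewrite ?eqxx // => *; rewrite ?[hi _ _ == _]eq_sym; lia.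
have gC := gadget_sym; have cC := gadget_colour_sym.
move=> u v w um vm wm; have [ur|ur] := boolP (u %% 5 < 2);
have [vr|vr] := boolP (v %% 5 < 2); have [wr|wr] := boolP (w %% 5 < 2).
- rewrite /gadget ur vr wr => /andP[/eqP _ ?] /andP[/eqP _ ?] /andP[/eqP _ ?]; lia.
- exact: P1.
- move=> uv vw uw; have := P1 u w v ur wr vr uw; rewrite gC vw uv => /(_ isT isT) <-.
  by rewrite [gadget_colour w v]cC; lia.
- exact: P2.
- move=> uv vw uw; have := P1 v w u vr wr ur vw; rewrite gC uw gC uv => /(_ isT isT) <-.
  by rewrite [gadget_colour w u]cC [gadget_colour v u]cC; lia.
- move=> uv vw uw; have := P2 v u w vr ur wr; rewrite gC uw vw uv => /(_ isT isT isT) <-.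
  by rewrite [gadget_colour v u]cC; lia.
- move=> uv vw uw; have := P2 w u v wr ur vr; rewrite gC uw uv gC vw => /(_ isT isT isT) <-.
  by rewrite [gadget_colour w u]cC [gadget_colour w v]cC; lia.
rewrite /gadget /gadget_colour (negPf ur) (negPf vr) (negPf wr).
move=> /andP[/eqP <- n1] /andP[/eqP <- n2] /andP[_ n3]; rewrite !minnn.
have := gP (u %/ 5); rewrite ltn_divLR // => /(_ um); rewrite /inner.
have := ltn_pmod u (isT : 0 < 5); have := ltn_pmod v (isT : 0 < 5).
have := ltn_pmod w (isT : 0 < 5).
move: (u %% 5) (v %% 5) (w %% 5) ur vr wr n1 n2 n3 => r r' r''.
case: r => [|[|[|[|[|]]]]] //; case: r' => [|[|[|[|[|]]]]] //;
case: r'' => [|[|[|[|[|]]]]] //= *; lia.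
Qed.

End ColouringOfAssignment.

Lemma gadget_correct :
  (exists c, one_in_triangles (m * 5) gadget c) <-> (exists g, one_in_three g).
Proof.
rewrite (one_in_triangles_sym (@gadget_matrix (m * 5))); split=> [[c [cC cP]]|[g gP]]; last first.
  by exists (gadget_colour g); split; [exact: gadget_colour_sym | exact: gadget_colourP].
(* The equations of the two triangles on uv, minus those of the two triangles on wz, leave 2c(uv) =
   2c(wz). *)
have K4 u v w z : u < m * 5 -> v < m * 5 -> w < m * 5 -> z < m * 5 ->
    gadget u v -> gadget w z -> gadget u w -> gadget u z -> gadget v w -> gadget v z ->
    c u v = c w z.
  move=> um vm wm zm uv wz uw uz vw vz.
  move: (cP u v w um vm wm uv vw uw) (cP u v z um vm zm uv vz uz).
  by move: (cP u w z um wm zm uw wz uz) (cP v w z vm wm zm vw wz vz); clear; lia.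
exists (fun x => c (x * 5) (x * 5 + 1)) => b bm.
have opp k r r' : k < 3 -> 1 < r < 5 -> 1 < r' < 5 -> r != r' ->
    link b (lit b k) r -> link b (lit b k) r' ->
    c (lit b k * 5) (lit b k * 5 + 1) = c (b * 5 + r) (b * 5 + r').
  move=> k3 r5 r'5 nr l l'; have xm := lit_lt k bm; set x := lit b k in l l' xm *.
  have gx : gadget (x * 5) (x * 5 + 1) by rewrite -{1}[x * 5]addn0; exact: gadget_block.
  have gl r0 : 1 < r0 < 5 -> link b x r0 ->
      gadget (x * 5) (b * 5 + r0) /\ gadget (x * 5 + 1) (b * 5 + r0).
    case/andP=> r1 r5' lr; rewrite -{1}[x * 5]addn0 !(gadget_sym (x * 5 + _)).
    by split; apply: gadget_link.
  have [g1 g2] := gl r r5 l; have [g3 g4] := gl r' r'5 l'.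
  by apply: K4 => //; [clear -bm xm k3 r5 r'5; lia.. | apply: gadget_block => //; clear -r5 r'5; lia].
(* The edge standing for [lit b k] joins the two vertices other than [k + 2]. *)
rewrite (opp 0 3 4) // /link ?eqxx //.
rewrite (opp 1 2 4) // /link ?eqxx ?orbT //.
rewrite (opp 2 2 3) // /link ?eqxx ?orbT //.
have gb := @gadget_block b.
have lt r : r < 5 -> b * 5 + r < m * 5 by lia.
move: (cP _ _ _ (lt 2 isT) (lt 3 isT) (lt 4 isT)); rewrite !gb // => /(_ isT isT isT).
by clear; lia.
Qed.

End OneInThree.

(** * From wide clauses to 1-in-3 satisfiability *)

(** The same numbering serves for variables and constraints, since block b of the graph carries both
    variable b and constraint b. *)
Definition code ty i := i * 8 + ty.

Lemma code_mod ty i : ty < 8 -> code ty i %% 8 = ty.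
Proof. by move=> lt; rewrite /code modnMDl modn_small. Qed.

Lemma code_div ty i : ty < 8 -> code ty i %/ 8 = i.
Proof. by move=> lt; rewrite /code divnMDl // divn_small ?addn0. Qed.

Definition cnf_sat (nc nv : nat) (pos neg : nat -> nat -> bool) : Prop :=
  exists a : nat -> bool, forall c, c < nc ->
    exists2 v, v < nv & (pos c v && a v) || (neg c v && ~~ a v).

Section Selectors.

Variables (nc nv : nat) (pos neg : nat -> nat -> bool).

(* Variables of the 1-in-3 instance, with p = c * nv + v: code 0 v and code 1 v
   are v and its negation; code 2 p says that v is the literal selected in clause
   c, code 4 p that a literal before v is selected, code 5 p is the negation of
   code 4 p, code 3 p is a slack; code 6 i, for i < 5, are constants, of which
   i = 2, 3 are false and i = 4 is true. The variable [cell_negation p] is the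
   negation of the occurrence of v in c (false if v occurs with both signs). *)
Definition cell_negation p :=
  let c := p %/ nv in let v := p %% nv in
  if pos c v then (if neg c v then code 6 2 else code 1 v)
  else if neg c v then code 0 v else code 6 4.

(** Write S and W for codes 4 and 2. Type 0 says S(i) + W(i) = S(i + 1) along a row, with false at
    its start and true forced after its end. Types 1 and 3 make codes 5 and 1 the negations of codes
    4 and 0. Type 2 keeps W from selecting a false literal, up to the slack. The other types fix the
    constants: c0 + c1 + c2 = c0 + c1 + c3 = c2 + c3 + c4 = 1 forces c2 = c3 = 0 and c4 = 1. Two
    false constants keep the variables of a constraint distinct even in a row of length 1. *)
Definition lit0 ty i :=
  if ty == 0 then (if i %% nv == 0 then code 6 3 else code 4 i)
  else if ty == 1 then code 5 i
  else if ty == 2 then code 2 i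
  else if ty == 3 then code 0 i
  else if i < 2 then code 6 0 else code 6 2.

Definition lit1 ty i :=
  if ty == 0 then code 2 i
  else if ty == 1 then code 4 i
  else if ty == 2 then code 3 i
  else if ty == 3 then code 1 i
  else if i < 2 then code 6 1 else code 6 3.

Definition lit2 ty i :=
  if ty == 0 then (if i.+1 %% nv == 0 then code 6 2 else code 5 i.+1)
  else if ty == 1 then code 6 2
  else if ty == 2 then cell_negation i
  else if ty == 3 then code 6 2
  else if i == 0 then code 6 2 else if i == 1 then code 6 3 else code 6 4.

Definition selector b k :=
  if k == 0 then lit0 (b %% 8) (b %/ 8)
  else if k == 1 then lit1 (b %% 8) (b %/ 8) else lit2 (b %% 8) (b %/ 8).

Hypotheses (nc5 : 4 < nc) (nv0 : 0 < nv).

Lemma selector_lt b k : b < nc * nv * 8 -> selector b k < nc * nv * 8.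
Proof.
move=> bm; have im : b %/ 8 < nc * nv by rewrite ltn_divLR.
have vm : (b %/ 8) %% nv < nc * nv.
  by apply: leq_trans (ltn_pmod _ nv0) _; apply: leq_pmull; lia.
have cm ty i : ty < 8 -> i < nc * nv -> code ty i < nc * nv * 8 by rewrite /code; lia.
have n5 : 4 < nc * nv by nia.
(* The successor is only used inside a row, and [nc * nv] would start a new one. *)
have sm : (b %/ 8).+1 %% nv != 0 -> (b %/ 8).+1 < nc * nv.
  move=> nz; rewrite ltn_neqAle im andbT; apply: contraNN nz => /eqP->; by rewrite modnMl.
rewrite /selector /lit0 /lit1 /lit2 /cell_negation.
repeat (case: ifPn => //; intros); apply: cm => //; try (by clear -n5; lia); exact: sm.
Qed.

Lemma selector_neq b :
  [/\ selector b 0 <> selector b 1, selector b 0 <> selector b 2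
    & selector b 1 <> selector b 2].
Proof.
rewrite /selector /= /lit0 /lit1 /lit2 /cell_negation /code.
move: (b %% 8) (b %/ 8) => [|[|[|[|ty]]]] i /=;
  by split; repeat (case: ifP); clear; lia.
Qed.

Lemma selector_correct :
  cnf_sat nc nv pos neg <-> exists g, one_in_three (nc * nv * 8) selector g.
Proof.
split=> [[a aP]|[g gP]].
  pose t c v := (pos c v && a v) || (neg c v && ~~ a v).
  (* The first true literal of each clause is the selected one. *)
  pose f c := find (t c) (iota 0 nv).
  have fP c : c < nc -> f c < nv /\ t c (f c).
    move=> /aP[v vn tv]; have hs : has (t c) (iota 0 nv).
      by apply/hasP; exists v => //; rewrite mem_iota.
    have lt : f c < nv by rewrite -[X in _ < X](size_iota 0) -has_find.
    by split=> //; have := nth_find 0 hs; rewrite nth_iota.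
  pose S p := f (p %/ nv) < p %% nv.
  pose W p := p %% nv == f (p %/ nv).
  pose tr p := t (p %/ nv) (p %% nv).
  pose g b := let i := b %/ 8 in
    nth false [:: a i; ~~ a i; W i; ~~ W i && tr i; S i; ~~ S i; (i == 0) || (i == 4)] (b %% 8).
  have gE ty i : ty < 8 -> g (code ty i) =
    nth false [:: a i; ~~ a i; W i; ~~ W i && tr i; S i; ~~ S i; (i == 0) || (i == 4)] ty.
    by move=> lt; rewrite /g code_mod ?code_div.
  exists g => b bm; have im : b %/ 8 < nc * nv by rewrite ltn_divLR.
  rewrite /selector /lit0 /lit1 /lit2 /=; move: (b %/ 8) im (b %% 8) => i im ty.
  have cn : i %/ nv < nc by rewrite ltn_divLR.
  have [fn tf] := fP _ cn; have vn := ltn_pmod i nv0.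
  case: ty => [|[|[|[|ty]]]] /=.
  - rewrite gE //= (fun_if g) (fun_if g) !gE //=.
    have -> : (if i %% nv == 0 then false else S i) = S i.
      by case: eqP => // E; rewrite /S E.
    (* At the end of a row no later literal can be selected, in agreement with the constant false
       placed there. *)
    have -> : (if i.+1 %% nv == 0 then false else ~~ S i.+1) = (i %% nv < f (i %/ nv)).
      have [d|nd] := boolP (nv %| i.+1).
        rewrite (eqP d) eqxx; symmetry; apply/negbTE; rewrite -leqNgt -ltnS.
        apply: leq_trans fn _; apply: dvdn_leq => //.
        by rewrite -(dvdn_addr _ (dvdn_mull (i %/ nv) (dvdnn nv))) addnS -divn_eq.
      have nz : i.+1 %% nv != 0 by [].
      have lt : (i %% nv).+1 < nv.
        rewrite ltn_neqAle vn andbT; apply: contraNN nd => /eqP E.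
        by apply/dvdnP; exists (i %/ nv).+1; rewrite {1}(divn_eq i nv) -addnS E mulSn addnC.
      have E : i.+1 = i %/ nv * nv + (i %% nv).+1 by rewrite addnS -divn_eq.
      have Ed : i.+1 %/ nv = i %/ nv by rewrite E divnMDl // (divn_small lt) addn0.
      have Em : i.+1 %% nv = (i %% nv).+1 by rewrite E modnMDl (modn_small lt).
      by rewrite (negPf nz) /S Ed Em -leqNgt.
    by rewrite /S /W; case: ltngtP.
  - rewrite !gE //=; by case: (S i).
  - rewrite !gE //= /cell_negation !(fun_if g) !gE //=.
    have : W i ==> tr i by rewrite /W /tr; apply/implyP => /eqP ->.
    rewrite /tr /t; case: (W i) (pos _ _) (neg _ _) (a _) => [] [] [] [] //.
  - by rewrite !gE //=; case: (a i).
  - by rewrite !(fun_if g) !gE //=; case: i {im cn fn tf vn} => [|[|i]].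
have n5 : 4 < nc * nv by nia.
have gE ty i : ty < 8 -> i < nc * nv -> g (lit0 ty i) + g (lit1 ty i) + g (lit2 ty i) = 1.
  move=> ty8 im; have := gP (code ty i); rewrite /selector /= code_mod // code_div //.
  by apply; rewrite /code; lia.
have := gE 4 0 isT (ltn_trans (isT : 0 < 4) n5).
have := gE 4 1 isT (ltn_trans (isT : 1 < 4) n5).
have := gE 4 2 isT (ltn_trans (isT : 2 < 4) n5).
rewrite /lit0 /lit1 /lit2 /= => k2 k1 k0.
have z0 : g (code 6 2) = false by move: k2 k1 k0; clear; lia.
have z1 : g (code 6 3) = false by move: k2 k1 k0; clear; lia.
have o1 : g (code 6 4) by move: k2 k1 k0; clear; lia.
have X v : v < nv -> g (code 1 v) = ~~ g (code 0 v).
  move=> vn; have := gE 3 v isT; rewrite /lit0 /lit1 /lit2 /= z0 => E.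
  by have := E (leq_trans vn (leq_pmull _ (ltnW (ltnW (ltnW (ltnW nc5)))))); clear; lia.
exists (fun v => g (code 0 v)) => c cn.
pose t v := pos c v && g (code 0 v) || neg c v && ~~ g (code 0 v).
have [/hasP[v]|none] := boolP (has t (iota 0 nv)).
  by rewrite mem_iota => vn tv; exists v.
exfalso; have {}none v : v < nv -> ~~ t v.
  by move=> vn; apply: contra none => tv; apply/hasP; exists v => //; rewrite mem_iota.
have pE v : v < nv -> [/\ c * nv + v < nc * nv, (c * nv + v) %/ nv = c & (c * nv + v) %% nv = v].
  by move=> vn; rewrite divnMDl // modnMDl divn_small // modn_small // addn0; split=> //; nia.
have W v : v < nv -> g (code 2 (c * nv + v)) = false.
  move=> vn; have [pm pd pv] := pE v vn.
  have := gE 2 _ isT pm; rewrite /lit0 /lit1 /lit2 /= /cell_negation pd pv.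
  have := none v vn; rewrite /t.
  have -> : g (if pos c v then if neg c v then code 6 2 else code 1 v
               else if neg c v then code 0 v else code 6 4) = ~~ t v.
    rewrite /t !(fun_if g) z0 o1 X //.
    by case: (pos c v) (neg c v) (g (code 0 v)) => [] [] [].
  by rewrite -/(t v) => ->; clear; lia.
(* With nothing selected, false is carried along the row until the constraint of the last cell has
   no true variable. *)
have N v : v < nv -> ~~ g (lit0 0 (c * nv + v)) -> g (lit2 0 (c * nv + v)).
  move=> vn; have [pm pd pv] := pE v vn; have := gE 0 _ isT pm.
  by rewrite [lit1 _ _]/(code 2 _) W //; clear; lia.
have S v : v < nv -> ~~ g (lit0 0 (c * nv + v)).
  elim: v => [|v IH] vn; first by rewrite /lit0 /= addn0 modnMl eqxx z1.
  have := N v (ltnW vn) (IH (ltnW vn)); have [pm pd pv] := pE _ vn.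
  rewrite /lit0 /lit2 /= -addnS pv /= => n5'; have := gE 1 _ isT pm.
  by rewrite /lit0 /lit1 /lit2 /= n5' z0; clear; lia.
have lt : nv.-1 < nv by rewrite prednK.
have := N _ lt (S _ lt).
by rewrite /lit2 /= -addnS prednK // -mulSnr modnMl eqxx z0.
Qed.

End Selectors.

(** * Composition of the reductions from clauses to graphs *)

Notation cpt2 F := (forall f g, computable f -> computable g ->
  computable (fun w rho => F w (f w rho) (g w rho))).

Section Reduction.

Variables (nc nv : seq bool -> nat) (pos neg : seq bool -> nat -> nat -> bool).
Hypothesis nc_cpt : computable (fun w _ => nc (w false)).
Hypothesis nv_cpt : computable (fun w _ => nv (w false)).
Hypothesis pos_cpt : cpt2 (fun w c v => pos (w false) c v).
Hypothesis neg_cpt : cpt2 (fun w c v => neg (w false) c v).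

Let lit x := selector (nv x) (pos x) (neg x).

Ltac cpt_hook ::= first [apply: pos_cpt | apply: neg_cpt | exact: nv_cpt | exact: nc_cpt].

Lemma computable_lit k f :
  computable f -> computable (fun w rho => lit (w false) (f w rho) k).
Proof.
move=> cf; rewrite /lit /selector; case: k => [|[|k]] /=.
- by rewrite /lit0 /code; cpt.
- by rewrite /lit1 /code; cpt.
- by rewrite /lit2 /cell_negation /code /=; cpt.
Qed.

Ltac cpt_hook ::= apply: computable_lit.

Lemma computable_gadget : cpt2 (fun w u v => gadget (lit (w false)) u v).
Proof. by move=> f g cf cg; rewrite /gadget /link; cpt. Qed.

Ltac cpt_hook ::= first [exact: nv_cpt | exact: nc_cpt | apply: computable_gadget].

Lemma cnf_reduction b (L : language) :
  (forall x, 4 < nc x /\ 0 < nv x) ->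
  (forall x, L x <-> cnf_sat (nc x) (nv x) (pos x) (neg x)) ->
  poly_reducible L (free_colouring_problem (triangle_family b)).
Proof.
move=> ncv LP; pose n x := nc x * nv x * 8 * 5.
exists (fun x => matrix_word (n x) (gadget (lit x))); split.
  have : polytime1 (fun x => mkseq (matrix_bit (n x) (gadget (lit x))) (n x + (n x * n x).+1)).
    apply: polytime1_mkseq; rewrite /matrix_bit /n; cpt.
  by case=> M [p Mp]; exists M, p => x; rewrite matrix_word_mkseq.
move=> x; have [nc5 nv0] := ncv x.
rewrite triangle_problem_matrix; last exact: gadget_matrix.
rewrite LP selector_correct // /n gadget_correct //.
  by move=> c k; apply: selector_lt.
by move=> c; apply: selector_neq.
Qed.

End Reduction.

Ltac cpt_hook ::= fail.

(** * Clauses indexed by a finite kind and two coordinates *)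

Definition code3 (K D r t j : nat) := (t * D + j) * K + r.

Section StructuredCnf.

Variables (F V : finType) (D : nat).
Variables (P N : F -> nat -> nat -> V -> nat -> nat -> bool).

(** Disjunctions over the enumerations of two fixed finite types, rather than a decoding of ranks,
    so that [cpt_has_const] applies. *)
Definition flat (Q : F -> nat -> nat -> V -> nat -> nat -> bool) (c v : nat) : bool :=
  has (fun f => has (fun a => [&& c %% #|F| == enum_rank f, v %% #|V| == enum_rank a &
    Q f (c %/ #|F| %/ D) (c %/ #|F| %% D) a (v %/ #|V| %/ D) (v %/ #|V| %% D)]) (enum V)) (enum F).

Hypotheses (D0 : 0 < D).

Lemma code3_lt K r t j : r < K -> t < D -> j < D -> code3 K D r t j < D * D * K.
Proof.
rewrite /code3 => rK tD jD.
have h1 : t * D + j < D * D by nia.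
by nia.
Qed.

Lemma code3_split K c : c < D * D * K ->
  exists r t j, [/\ r < K, t < D, j < D & c = code3 K D r t j].
Proof.
move=> lt; have K0 : 0 < K by case: K lt => //; rewrite muln0.
exists (c %% K), (c %/ K %/ D), (c %/ K %% D); rewrite !ltn_mod K0 D0.
by rewrite !ltn_divLR //; split=> //; rewrite /code3 -!divn_eq.
Qed.

Lemma code3K K r t j : r < K -> j < D ->
  [/\ code3 K D r t j %% K = r, code3 K D r t j %/ K %/ D = t
    & code3 K D r t j %/ K %% D = j].
Proof.
move=> rK jD; have K0 : 0 < K by exact: leq_ltn_trans rK.
rewrite /code3 modnMDl (modn_small rK) divnMDl // (divn_small rK) addn0.
by rewrite divnMDl // modnMDl (modn_small jD) (divn_small jD) addn0.
Qed.

Lemma flatE Q f t j a t' j' : j < D -> j' < D ->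
  flat Q (code3 #|F| D (enum_rank f) t j) (code3 #|V| D (enum_rank a) t' j') =
  Q f t j a t' j'.
Proof.
move=> jD j'D.
have [e1 e2 e3] := code3K t (ltn_ord (enum_rank f)) jD.
have [e4 e5 e6] := code3K t' (ltn_ord (enum_rank a)) j'D.
rewrite /flat e1 e2 e3 e4 e5 e6.
apply/hasP/idP => [[f' _ /hasP[a' _ /and3P[/eqP ef /eqP ea]]]|q].
  by rewrite (enum_rank_inj (val_inj ef)) (enum_rank_inj (val_inj ea)).
exists f; rewrite ?mem_enum //; apply/hasP; exists a; first by rewrite mem_enum.
by rewrite !eqxx.
Qed.

Lemma structured_cnf :
  cnf_sat (D * D * #|F|) (D * D * #|V|) (flat P) (flat N) <->
  exists A : V -> nat -> nat -> bool, forall f t j, t < D -> j < D ->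
    exists a t' j', [/\ t' < D, j' < D &
      (P f t j a t' j' && A a t' j') || (N f t j a t' j' && ~~ A a t' j')].
Proof.
split=> [[A AP]|[A AP]].
  exists (fun a t j => A (code3 #|V| D (enum_rank a) t j)) => f t j tD jD.
  have [v vn] := AP _ (code3_lt (ltn_ord (enum_rank f)) tD jD).
  have [r [t' [j' [rV t'D j'D ->]]]] := code3_split vn.
  have [a <-] := rankP rV.
  by rewrite !flatE // => h; exists a, t', j'.
pose B v := has (fun a => (v %% #|V| == enum_rank a) && A a (v %/ #|V| %/ D) (v %/ #|V| %% D)) (enum V).
exists B => c cn; have [r [t [j [rF tD jD ->]]]] := code3_split cn.
have [f <-] := rankP rF; have [a [t' [j' [t'D j'D h]]]] := AP f t j tD jD.
exists (code3 #|V| D (enum_rank a) t' j'); first exact: code3_lt.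
have -> : B (code3 #|V| D (enum_rank a) t' j') = A a t' j'.
  have [e1 e2 e3] := code3K t' (ltn_ord (enum_rank a)) j'D.
  rewrite /B e1 e2 e3.
  apply/hasP/idP => [[a' _ /andP[/eqP ea]]|q].
    by rewrite (enum_rank_inj (val_inj ea)).
  by exists a; rewrite ?mem_enum // eqxx.
by rewrite !flatE.
Qed.

End StructuredCnf.

(** * The tableau of a machine *)

Section Tableau.

Variable M : machine.
Notation Q := (tm_state M).
Notation sym := (symbol (tm_aux M)).
Notation I := 'I_(tm_tapes M).+1.
Notation reads := {ffun I -> sym}.
Notation bits u := [seq (Some (inl c) : sym) | c <- u].

(** A halted machine is viewed as rewriting what it scans and staying, so that one rule covers every
    step. *)
Definition effect (s : Q) (r : reads) : Q * {ffun I -> sym * move} :=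
  if tm_halt s then (s, [ffun i => (r i, Stay)]) else tm_delta s r.

(** Relatively to the head a move shifts the tape: cell [j] after the move is cell [source m j]
    before it. For [Left] at [j = 0] this is a default value, avoided by requiring [0 < j]. *)
Definition source (m : move) (j : nat) : nat :=
  match m with Left => j.-1 | Stay => j | Right => j.+1 end.

(* The content of the tape with its head moved to cell W. *)
Definition cell (W : nat) (t : tape (tm_aux M)) (j : nat) : sym :=
  if j < W then nth None t.1 (W - j.+1) else nth None t.2 (j - W).

Definition reading (c : config M) : reads := [ffun i => read_tape (c.2 i)].

Lemma read_cell W t : read_tape t = cell W t W.
Proof. by rewrite /cell ltnn subnn /read_tape; case: t.2. Qed.

Lemma cell_move W m s t j :
  0 < j -> 0 < W ->
  cell W (move_tape m (write_tape s t)) j =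
  if source m j == W then s else cell W t (source m j).
Proof.
move=> j0 W0; rewrite /cell; case: m => /=.
- case: j j0 => // j _ /=; have [lt|gt|E] := ltngtP j W.
  + case: ltnP => jW; first by rewrite nth_behead; congr (nth _ _ _); lia.
    have -> : j.+1 = W by lia.
    by rewrite subnn /= -nth0; congr (nth _ _ _); lia.
  + rewrite ifN; last by lia.
    have -> : j.+1 - W = (j - W.+1).+2 by lia.
    by rewrite /= nth_behead; congr (nth _ _ _); lia.
  + rewrite E ifN; last by lia.
    by rewrite subSnn.
- have [lt|gt|->] := ltngtP j W; last by rewrite subnn.
    by [].
  have -> : j - W = (j - W.+1).+1 by lia.
  by rewrite /= nth_behead.
- have [lt|gt|<-] := ltngtP j.+1 W.
  + have -> : W - j.+1 = (W - j.+2).+1 by lia.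
    by [].
  + by rewrite nth_behead; congr (nth _ _ _); lia.
  + by rewrite subnn.
Qed.

Lemma step_state (c : config M) : (step c).1 = (effect c.1 (reading c)).1.
Proof. by rewrite /step /effect; case: ifP. Qed.

Lemma step_cell W (c : config M) i j :
  0 < j -> 0 < W ->
  let e := (effect c.1 (reading c)).2 i in
  cell W ((step c).2 i) j = if source e.2 j == W then e.1 else cell W (c.2 i) (source e.2 j).
Proof.
move=> j0 W0 /=; rewrite /step /effect; case: ifP => _ /=.
  by rewrite !ffunE /=; case: eqP => // ->; rewrite -read_cell.
by rewrite ffunE cell_move.
Qed.

Lemma cell_tape_of W w j :
  cell W (tape_of (tm_aux M) w) j = if j < W then None else nth None (bits w) (j - W).
Proof. by rewrite /cell nth_nil. Qed.

Definition accepting (c : config M) : bool := read_tape (c.2 ord_max) == Some (inl true).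

Lemma accepting_output T ws b m :
  outputs_within M m ws [:: b] -> m <= T ->
  accepting (iter T (@step M) (init M ws)) = b.
Proof.
case=> h o le; have -> : iter T (@step M) (init M ws) = iter m (@step M) (init M ws).
  rewrite -(subnK le) iterD; elim: (T - m) => //= n ->; by rewrite /step h.
move: o; rewrite /output /accepting /read_tape.
by move: (iter _ _ _).2 => t; case: (t ord_max) => l [|[[c|]|] r] //= [->]; case: (b).
Qed.

Section Clauses.

Variables (x : seq bool) (T q : nat).

Let W := T.+1.
(** A common bound for times and cells. Information travels one cell per step, so at time t only the
    cells from t to D - t - 1 are controlled; the head cell [W = T + 1] is among them up to time T,
    and at time 0 the [q] certificate cells fit to its right. *)
Definition horizon := T + T + q + 3.
Notation D := horizon.

Notation var := (Q + I * sym)%type.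
Notation kind := ('I_7 * Q * reads * I * sym)%type.

(* inl s at (t, 0): the state is s at time t; inr (i, s) at (t, j): at time t, the
   cell j - W to the right of the head of tape i contains s. *)
Definition at_var (b : var) (t j : nat) (a : var) (t' j' : nat) : bool :=
  [&& a == b, t' == t & j' == j].

(** Only the [q] cells of tape 1 from [W] on are left open: they hold the certificate. *)
Definition init_guard (i : I) (s : sym) (j : nat) : bool :=
  if val i == 0 then
    if W <= j then
      if j - W < size x then
        if nth false x (j - W) then s == Some (inl true) else s == Some (inl false)
      else s == None
    else s == None
  else (s == None) && [|| val i != 1, j < W | W + q <= j].

Definition situation (s : Q) (r : reads) (t : nat) (a : var) (t' j' : nat) : bool :=
  at_var (inl s) t 0 a t' j' ||
  [&& if a is inr (i, s') then r i == s' else false, t' == t & j' == W].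

(** Kinds of clauses: 0 start state, 1 known initial cells, 2 a certificate cell holds a bit or a
    blank, 3 blanks of the certificate extend to the right, 4 next state, 5 next content of a cell,
    6 at time T the last tape scans nothing but the bit 1. *)
Definition guard (k : nat) (s : Q) (r : reads) (i : I) (u : sym) (t j : nat) : bool :=
  match k with
  | 0 => true
  | 1 => init_guard i u j
  | 2 => [&& val i == 1, W <= j & j < W + q]
  | 3 => [&& val i == 1, W <= j & j.+1 < W + q]
  | 4 => t < T
  | 5 => [&& t < T, 0 < j & source ((effect s r).2 i).2 j < D]
  | _ => u != Some (inl true)
  end.

Definition pos_lits (k : nat) (s : Q) (r : reads) (i : I) (u : sym) (t j : nat)
    (a : var) (t' j' : nat) : bool :=
  match k with
  | 0 => at_var (inl (tm_start M)) 0 0 a t' j'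
  | 1 => at_var (inr (i, u)) 0 j a t' j'
  | 2 => [|| at_var (inr (i, None)) 0 j a t' j', at_var (inr (i, Some (inl true))) 0 j a t' j'
           | at_var (inr (i, Some (inl false))) 0 j a t' j']
  | 3 => at_var (inr (i, None)) 0 j.+1 a t' j'
  | 4 => at_var (inl (effect s r).1) t.+1 0 a t' j'
  | 5 => let e := (effect s r).2 i in
         if source e.2 j == W then at_var (inr (i, e.1)) t.+1 j a t' j'
         else at_var (inr (i, u)) t.+1 j a t' j'
  | _ => false
  end.

Definition neg_lits (k : nat) (s : Q) (r : reads) (i : I) (u : sym) (t j : nat)
    (a : var) (t' j' : nat) : bool :=
  match k with
  | 3 => at_var (inr (i, None)) 0 j a t' j'
  | 4 => situation s r t a t' j'
  | 5 => situation s r t a t' j' || at_var (inr (i, u)) t (source ((effect s r).2 i).2 j) a t' j'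
  | 6 => at_var (inr (ord_max, u)) T W a t' j'
  | _ => false
  end.

(* A clause whose guard fails contains every literal. *)
Definition tableau_pos (f : kind) t j a t' j' : bool :=
  let: (k, s, r, i, u) := f in ~~ guard k s r i u t j || pos_lits k s r i u t j a t' j'.

Definition tableau_neg (f : kind) t j a t' j' : bool :=
  let: (k, s, r, i, u) := f in ~~ guard k s r i u t j || neg_lits k s r i u t j a t' j'.

Definition tableau_sat (A : var -> nat -> nat -> bool) : Prop :=
  forall f t j, t < D -> j < D -> exists a t' j', [/\ t' < D, j' < D &
    (tableau_pos f t j a t' j' && A a t' j') || (tableau_neg f t j a t' j' && ~~ A a t' j')].

Lemma at_varP b t j a t' j' : at_var b t j a t' j' -> [/\ a = b, t' = t & j' = j].
Proof. by case/and3P => /eqP -> /eqP -> /eqP ->. Qed.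

(** A clause in force, read as an implication from its negated variables to one of the others. *)
Lemma tableau_use A : tableau_sat A ->
  forall k, k < 7 -> forall s r i u t j, t < D -> j < D -> guard k s r i u t j ->
  (forall a t' j', neg_lits k s r i u t j a t' j' -> A a t' j') ->
  exists a t' j', pos_lits k s r i u t j a t' j' /\ A a t' j'.
Proof.
move=> sat k k7 s r i u t j tD jD g neg.
have [a [t' [j' [_ _]]]] := sat (Ordinal k7, s, r, i, u) t j tD jD.
rewrite /tableau_pos /tableau_neg /= g /= => h; exists a, t', j'; move: h.
case/orP => /andP[h1 h2]; first by [].
by rewrite neg in h2.
Qed.

Section Run.

Variable y : seq bool.
Hypothesis yq : size y <= q.

Let run t := iter t (@step M) (init M [:: x; y]).

Lemma init_cell (i : I) j :
  cell W ((run 0).2 i) j =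
  if j < W then None else
  if val i == 0 then nth None (bits x) (j - W)
  else if val i == 1 then nth None (bits y) (j - W) else None.
Proof.
rewrite /run /= ffunE cell_tape_of; case: ifP => // _.
by case: (val i) => [|[|k]] //=; rewrite nth_nil /= nth_nil.
Qed.

Lemma nth_bits u k : nth None (bits u) k = if k < size u then Some (inl (nth false u k)) else None.
Proof. by case: ltnP => h; [rewrite (nth_map false) | rewrite nth_default ?size_map]. Qed.

Lemma init_guardP i s j : init_guard i s j -> cell W ((run 0).2 i) j = s.
Proof.
rewrite init_cell /init_guard; case: eqP => _.
  rewrite [j < W]ltnNge; case: (W <= j) => /=; last by move/eqP.
  by rewrite nth_bits; case: ifP => _; [case: nth|] => /eqP.
case/andP => /eqP -> h; case: ltnP => // Wj; case: eqP h => // _ /=.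
by rewrite ltnNge Wj /= => h; rewrite nth_bits ifN // -leqNgt (leq_trans yq) // leq_subRL.
Qed.

Definition run_values (a : var) (t j : nat) : bool :=
  match a with
  | inl s => (run t).1 == s
  | inr (i, u) => cell W ((run t).2 i) j == u
  end.

(** When the run is in another situation, one of the negated literals of clauses 4 and 5 already
    holds. *)
Lemma situation_or s r t : t < D ->
  ((run t).1 = s /\ reading (run t) = r) \/
  exists a t' j', [/\ t' < D, j' < D & situation s r t a t' j' && ~~ run_values a t' j'].
Proof.
move=> tD; have WD : W < D by rewrite /W /horizon; lia.
have [E|ne] := eqVneq (run t).1 s; last first.
  right; exists (inl s), t, 0; split=> //; first by rewrite /horizon; lia.
  by rewrite /situation /at_var !eqxx.
have [E'|] := eqVneq (reading (run t)) r; first by left.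
move=> ne; right.
have /existsP[i nei] : [exists i, reading (run t) i != r i].
  apply: contraNT ne => /existsPn h; apply/eqP/ffunP => i; exact/eqP/negPn/h.
exists (inr (i, r i)), t, W; split=> //; rewrite /situation /at_var /= !eqxx /=.
by move: nei; rewrite ffunE (read_cell W).
Qed.

Lemma tableau_complete : accepting (run T) -> tableau_sat run_values.
Proof.
move=> acc [[[[k s] r] i] u] t j tD jD.
have D0 : 0 < D by rewrite /horizon; lia.
have WD : W < D by rewrite /W /horizon; lia.
have [g|ng] := boolP (guard k s r i u t j); last first.
  exists (inl (tm_start M)), 0, 0; rewrite /tableau_pos /tableau_neg ng /=.
  by split=> //; case: eqP.
suff [a [t' [j' [t'D j'D h]]]] : exists a t' j', [/\ t' < D, j' < D &
    (pos_lits k s r i u t j a t' j' && run_values a t' j') ||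
    (neg_lits k s r i u t j a t' j' && ~~ run_values a t' j')].
  by exists a, t', j'; split=> //; rewrite /tableau_pos /tableau_neg g.
have at_id b t0 j0 : at_var b t0 j0 b t0 j0 by rewrite /at_var !eqxx.
case: k g => -[|[|[|[|[|[|[|//]]]]]]] _ /=.
- by exists (inl (tm_start M)), 0, 0; rewrite at_id /= eqxx.
- by move=> g; exists (inr (i, u)), 0, j; rewrite at_id /= (init_guardP g) eqxx.
- case/and3P => i1 Wj _; have := init_cell i j.
  rewrite /= ltnNge Wj (eqP i1) /= nth_bits => E.
  by exists (inr (i, cell W ((run 0).2 i) j)), 0, j; split=> //; rewrite /run_values eqxx andbT E;
    case: ifP => _; [case: nth|]; rewrite !at_id ?orbT.
- case/and3P => i1 Wj jq; have jD' : j.+1 < D by move: jq; rewrite /W /horizon; lia.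
  have := init_cell i j; have := init_cell i j.+1.
  have [nW nW'] : (j < W) = false /\ (j.+1 < W) = false by move: Wj; rewrite /W; lia.
  rewrite /= nW nW' (eqP i1) /= !nth_bits => E' E.
  have [lt|ge] := ltnP (j - W) (size y).
    by exists (inr (i, None)), 0, j; rewrite at_id /= E lt orbT.
  exists (inr (i, None)), 0, j.+1; rewrite at_id /= E' ifN ?eqxx //.
  by rewrite -leqNgt (leq_trans ge) // leq_sub2r.
- move=> tT; have [[<- <-]|[a [t' [j' [h1 h2 h3]]]]] := situation_or s r tD; last first.
    by exists a, t', j'; rewrite h3 orbT.
  exists (inl (effect (run t).1 (reading (run t))).1), t.+1, 0.
  rewrite at_id /= -step_state eqxx; split=> //; by move: tT; rewrite /horizon; lia.
- case/and3P => tT j0 sD; have tD' : t.+1 < D by move: tT; rewrite /horizon; lia.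
  have [[es er]|[a [t' [j' [h1 h2 /andP[h3 h4]]]]]] := situation_or s r tD; last first.
    by exists a, t', j'; rewrite h3 h4 !orbT.
  have [E|ne] := eqVneq (cell W ((run t).2 i) (source ((effect s r).2 i).2 j)) u; last first.
    exists (inr (i, u)), t, (source ((effect s r).2 i).2 j); rewrite at_id /= ne !orbT.
    by split.
  exists (inr (i, cell W ((run t.+1).2 i) j)), t.+1, j; split=> //.
  rewrite [run_values _ _ _]eqxx andbT /= step_cell // es er E.
  by case: (_ == W); rewrite at_id.
- move=> nu; exists (inr (ord_max, u)), T, W; split=> //; first by rewrite /horizon; lia.
  by rewrite at_id /= -read_cell (eqP acc) eq_sym nu.
Qed.

Lemma tableau_sound A : tableau_sat A ->
  (forall j, j < D -> forall i : I, A (inr (i, cell W ((run 0).2 i) j)) 0 j) ->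
  accepting (run T).
Proof.
move=> sat A0.
have use := tableau_use sat.
have T0 : 0 < D by rewrite /horizon; lia.
(* Clauses 4 and 5 carry the facts of the run from t to t + 1 on a window that loses one cell at
   each side. *)
have inv t : t <= T -> A (inl (run t).1) t 0 /\
    forall i j, t <= j -> j < D - t -> A (inr (i, cell W ((run t).2 i) j)) t j.
  elim: t => [|t IH] tT.
    split; last by move=> i j _; rewrite subn0 => jD; exact: A0.
    have [] := use 0 isT (tm_start M) (reading (run 0)) ord0 None 0 0 T0 T0 isT; first by [].
    by move=> a [t' [j' [/at_varP[-> -> ->]]]].
  have [IHs IHc] := IH (ltnW tT).
  have sit a t' j' : situation (run t).1 (reading (run t)) t a t' j' -> A a t' j'.
    case/orP => [/at_varP[-> -> ->] //|/and3P[]].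
    case: a => // -[i u] /eqP <- /eqP -> /eqP ->; rewrite ffunE (read_cell W).
    by apply: IHc; rewrite /W /horizon; lia.
  have tD : t < D by rewrite /horizon; lia.
  split.
    have := use 4 isT (run t).1 (reading (run t)) ord0 None t 0 tD T0.
    by move=> /(_ tT sit) [a [t' [j' [/at_varP[-> -> ->]]]]]; rewrite -step_state.
  move=> i j tj jD; have j0 : 0 < j by exact: leq_ltn_trans tj.
  have jD' : j < D by lia.
  rewrite /= step_cell //; set e := (effect _ _).2 i.
  have sb : t <= source e.2 j < D - t.
    by rewrite /source; case: (e.2) => //; lia.
  case/andP: sb => ts sD'; have sD := leq_trans sD' (leq_subr _ _).
  have g : guard 5 (run t).1 (reading (run t)) i (cell W ((run t).2 i) (source e.2 j)) t j.
    by rewrite /= tT j0.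
  case: (use 5 isT _ _ _ _ _ _ tD jD' g) => [a t' j' /orP[/sit //|/at_varP[-> -> ->]]|].
    exact: IHc.
  by move=> a [t' [j']] /=; rewrite -/e; case: (_ == W) => -[] /at_varP[-> -> ->].
have [_ fin] := inv _ (leqnn T).
apply/negPn/negP => nacc.
have TD : T < D by rewrite /horizon; lia.
have := use 6 isT (run T).1 (reading (run T)) ord0 (read_tape ((run T).2 ord_max))
  0 0 T0 T0 nacc; case.
  move=> a t' j' /at_varP[-> -> ->]; rewrite (read_cell W); apply: fin; rewrite /W /horizon; lia.
by move=> a [t' [j' []]].
Qed.

End Run.

(** The certificate ends at the first cell that may be blank; a bit is 1 if its cell may contain 1.
    Otherwise clause 2 makes 0 possible, and clause 3 propagates the blank up to position [q]. *)
Lemma tableau_word A : tableau_sat A ->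
  exists2 y, size y <= q & forall j, j < D -> forall i : I,
    A (inr (i, cell W ((init M [:: x; y]).2 i) j)) 0 j.
Proof.
move=> sat; have use := tableau_use sat.
(* On a one-tape machine this is the default [ord0]; [i1] is only identified with a tape of index
   1. *)
pose i1 : I := inord 1; pose blank k := A (inr (i1, None)) 0 (W + k).
pose len := find blank (iota 0 q).
pose y := mkseq (fun k => A (inr (i1, Some (inl true))) 0 (W + k)) len.
have lenq : len <= q by rewrite -[X in _ <= X](size_iota 0) find_size.
have T0 : 0 < D by rewrite /horizon; lia.
exists y; first by rewrite size_mkseq.
move=> j jD i.
have byinit u : init_guard i u j -> A (inr (i, u)) 0 j.
  move=> g; have [//|a [t' [j' [/at_varP[-> -> ->] //]]]] :=
    use 1 isT (tm_start M) (reading (init M [:: x; y])) i u 0 j T0 jD g.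
rewrite (init_cell y) /= -/W.
have [jW|Wj] := ltnP j W.
  apply: byinit; rewrite /init_guard jW /= eqxx orbT; case: ifP => // _.
  by rewrite leqNgt jW.
have [i0|ni0] := eqVneq (i : nat) 0.
  apply: byinit; rewrite /init_guard /= i0 Wj nth_bits; case: (_ < size x) => //.
  by case: nth.
have [ei|ni1] := eqVneq (i : nat) 1; last first.
  by apply: byinit; rewrite /init_guard /= (negPf ni0) ni1.
have [qj|jq] := leqP (W + q) j.
  rewrite nth_bits ifN; last by rewrite size_mkseq -leqNgt (leq_trans lenq) // leq_subRL.
  by apply: byinit; rewrite /init_guard /= ei qj !orbT.
have Ei : i = i1 by apply: val_inj; rewrite /i1 /= inordK // -ei.
have Ej : j = W + (j - W) by rewrite subnKC.
have kq : j - W < q by rewrite ltn_subLR.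
rewrite nth_bits size_mkseq; have [kl|lk] := ltnP (j - W) len.
  rewrite nth_mkseq // -Ej.
  have [//|a [t' [j' [h At]]]] := use 2 isT (tm_start M) (reading (init M [:: x; y])) i None 0 j T0 jD
    (introT and3P (And3 (introT eqP ei) Wj jq)).
  have nb : ~~ blank (j - W).
    by have := before_find 0 kl; rewrite nth_iota // => /negbT.
  case nA: (A (inr (i1, Some (inl true))) 0 j); first by rewrite Ei.
  move: h; rewrite /= => /or3P[] /at_varP[ea et ej]; subst a t' j'.
  - by move: nb; rewrite /blank -Ej -Ei At.
  - by rewrite -Ei At in nA.
  - by [].
have hs : has blank (iota 0 q) by rewrite has_find size_iota (leq_ltn_trans lk).
have lq : len < q by exact: leq_ltn_trans kq.
have b0 : blank len by have := nth_find 0 hs; rewrite nth_iota.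
suff bk n : len + n < q -> blank (len + n).
  by have := bk (j - W - len); rewrite subnKC // /blank -Ej -Ei; apply.
elim: n => [|n IH] nq; first by rewrite addn0.
have {}IH := IH (ltn_trans (ltnSn _) (eq_ind _ (fun z => z < q) nq _ (addnS len n))).
have mD : W + (len + n) < D by rewrite /W /horizon; lia.
have lt : (W + (len + n)).+1 < W + q by rewrite -addnS ltn_add2l -addnS.
have g : guard 3 (tm_start M) (reading (init M [:: x; y])) i1 None 0 (W + (len + n)).
  by apply/and3P; split; rewrite ?leq_addr // -Ei; exact/eqP.
have [|a [t' [j' [/at_varP[-> -> ->]]]]] := use 3 isT _ _ _ _ _ _ T0 mD g.
- by move=> a t' j' /at_varP[-> -> ->].
- by rewrite /blank -!addnS.
Qed.

End Clauses.
End Tableau.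

(** * Computability of the clauses of the tableau *)

Section TableauComputable.

Variables (M : machine) (T q : seq bool -> nat).
Hypothesis T_cpt : computable (fun w _ => T (w false)).
Hypothesis q_cpt : computable (fun w _ => q (w false)).

Lemma computable_source m f : computable f -> computable (fun w rho => source m (f w rho)).
Proof.
move=> cf; case: m => //=; last exact: cpt_succ.
by apply: (cpt_ext _ (cpt_sub cf (cpt_const 1))) => w rho; rewrite subn1.
Qed.

Lemma computable_horizon : computable (fun w _ => horizon (T (w false)) (q (w false))).
Proof. by rewrite /horizon; cpt. Qed.

Ltac cpt_hook ::= first [exact: T_cpt | exact: q_cpt | exact: computable_horizon
  | apply: computable_source].

Lemma computable_guard k s r i u t j : computable t -> computable j ->
  computable (fun w rho => @guard M (w false) (T (w false)) (q (w false)) k s r i u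
                             (t w rho) (j w rho)).
Proof.
by move=> ct cj; case: k => [|[|[|[|[|[|k]]]]]]; rewrite /guard /init_guard; cpt.
Qed.

Lemma computable_at_var (b a : tm_state M + 'I_(tm_tapes M).+1 * symbol (tm_aux M)) t j t' j' :
  computable t -> computable j -> computable t' -> computable j' ->
  computable (fun w rho => at_var b (t w rho) (j w rho) a (t' w rho) (j' w rho)).
Proof. by move=> *; rewrite /at_var; cpt. Qed.

Lemma computable_situation s r (a : tm_state M + 'I_(tm_tapes M).+1 * symbol (tm_aux M)) t t' j' :
  computable t -> computable t' -> computable j' ->
  computable (fun w rho => situation (T (w false)) s r (t w rho) a (t' w rho) (j' w rho)).
Proof. by move=> *; rewrite /situation /at_var; cpt. Qed.

Ltac cpt_hook ::= first [exact: T_cpt | exact: q_cpt | exact: computable_horizon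
  | apply: computable_source | apply: computable_at_var | apply: computable_situation].

Lemma computable_pos_lits k s r i u a t j t' j' :
  computable t -> computable j -> computable t' -> computable j' ->
  computable (fun w rho => @pos_lits M (T (w false)) k s r i u
                             (t w rho) (j w rho) a (t' w rho) (j' w rho)).
Proof.
by move=> *; case: k => [|[|[|[|[|[|k]]]]]]; rewrite /pos_lits /=; cpt.
Qed.

Lemma computable_neg_lits k s r i u a t j t' j' :
  computable t -> computable j -> computable t' -> computable j' ->
  computable (fun w rho => @neg_lits M (T (w false)) k s r i u
                             (t w rho) (j w rho) a (t' w rho) (j' w rho)).
Proof.
by move=> *; case: k => [|[|[|[|[|[|[|k]]]]]]]; rewrite /neg_lits /=; cpt.
Qed.

Ltac cpt_hook ::= first [exact: T_cpt | exact: q_cpt | exact: computable_horizon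
  | apply: computable_guard | apply: computable_pos_lits | apply: computable_neg_lits].

Lemma computable_tableau_pos : cpt2 (fun w c v =>
  flat (horizon (T (w false)) (q (w false)))
    (@tableau_pos M (w false) (T (w false)) (q (w false))) c v).
Proof.
move=> f g cf cg; apply: cpt_has_const => -[[[[k s] r] i] u]; apply: cpt_has_const => a.
by rewrite /tableau_pos; cpt.
Qed.

Lemma computable_tableau_neg : cpt2 (fun w c v =>
  flat (horizon (T (w false)) (q (w false)))
    (@tableau_neg M (w false) (T (w false)) (q (w false))) c v).
Proof.
move=> f g cf cg; apply: cpt_has_const => -[[[[k s] r] i] u]; apply: cpt_has_const => a.
by rewrite /tableau_neg; cpt.
Qed.

End TableauComputable.

(** Natural coefficients make polynomials monotone, so the time bound at the maximal certificate
    length covers shorter certificates. *)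
Lemma leq_horner (p : {poly nat}) m n : m <= n -> p.[m]%R <= p.[n]%R.
Proof.
move=> mn; rewrite /horner; elim: (polyseq p) => [|a s IH] //=.
by apply: leq_add => //; apply: leq_mul.
Qed.

Lemma triangle_problem_NP_hard b : NP_hard (free_colouring_problem (triangle_family b)).
Proof.
move=> L [V [p [[M [t Mt]] LP]]].
pose q (x : seq bool) := p.[size x]%R; pose T (x : seq bool) := t.[size x + q x]%R.
have q_cpt : computable (fun w _ => q (w false)) by apply: cpt_poly; exact: cpt_size.
have T_cpt : computable (fun w _ => T (w false)).
  by apply: cpt_poly; apply: cpt_add => //; exact: cpt_size.
pose D x := horizon (T x) (q x).
have D_cpt : computable (fun w _ => D (w false)) by exact: computable_horizon.
pose kind := ('I_7 * tm_state M * {ffun 'I_(tm_tapes M).+1 -> symbol (tm_aux M)} *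
              'I_(tm_tapes M).+1 * symbol (tm_aux M))%type.
pose var := (tm_state M + 'I_(tm_tapes M).+1 * symbol (tm_aux M))%type.
have k0 : 0 < #|{: kind}|.
  by apply/card_gt0P; exists (ord0, tm_start M, [ffun=> None], ord0, None).
have v0 : 0 < #|{: var}| by apply/card_gt0P; exists (inl (tm_start M)).
apply: (@cnf_reduction (fun x => D x * D x * #|{: kind}|) (fun x => D x * D x * #|{: var}|)
  (fun x => flat (D x) (@tableau_pos M x (T x) (q x)))
  (fun x => flat (D x) (@tableau_neg M x (T x) (q x)))).
- by apply: cpt_mul; [exact: cpt_mul | exact: cpt_const].
- by apply: cpt_mul; [exact: cpt_mul | exact: cpt_const].
- exact: computable_tableau_pos.
- exact: computable_tableau_neg.
(* At least nine clauses, which leaves room for the five constants of the 1-in-3 instance. *)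
- by move=> x; have : 2 < D x by [rewrite /D /horizon; lia]; nia.
move=> x; rewrite structured_cnf; last by rewrite /D /horizon addn_gt0 orbT.
have acc y : size y <= q x -> accepting (iter (T x) (@step M) (init M [:: x; y])) = V x y.
  move=> yq; apply: (accepting_output (Mt x y)); apply: leq_horner; exact: leq_add.
rewrite LP; split=> [[y [yq Vxy]]|[A sat]].
  exists (run_values x (T x) y).
  by apply: (tableau_complete yq); rewrite acc.
have [y yq A0] := tableau_word sat.
by exists y; split=> //; rewrite -acc //; exact: tableau_sound sat A0.
Qed.

Theorem lemma39 (F : cfamily)
  (hF : F = cfamily3 bK3 rK3 rrbK3 \/ F = cfamily3 bK3 rK3 rbbK3) :
  NP_complete (free_colouring_problem F).
Proof.
have [b ->] : exists b, F = triangle_family b.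
  by case: hF => ->; [exists true | exists false].
by split; [exact: triangle_problem_in_NP | exact: triangle_problem_NP_hard].
Qed.
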